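(* Let $d\geq 2$ and let $0<r<R$. The spherical shell $A_{r,R} := \{x\in\mathbb{R}^d : r<|x|<R\}$ is a minimal Cheeger set, that is, $A_{r,R}$ attains the infimum defining $h(A_{r,R})$ and is the unique Cheeger set of itself (up to sets of Lebesgue measure zero), and $$h(A_{r,R}) = d\,\frac{R^{d-1}+r^{d-1}}{R^d-r^d}.$$
   Context: For an open connected set $\Omega\subset\mathbb{R}^d$, the Cheeger constant of $\Omega$ is $$h(\Omega) := \inf_{S\subset\Omega} \frac{|\partial S|}{|S|},$$ where the infimum is over all non-empty bounded Borel sets $S\subset\Omega$ (with $|S|>0$, so that the quotient makes sense), $|S|$ denotes the $d$-dimensional Lebesgue measure of $S$, and $|\partial S|$ denotes the perimeter of $S$ in $\mathbb{R}^d$ in the variational (De Giorgi) sense; for sets with smooth or Lipschitz boundary it equals the $(d-1)$-dimensional Hausdorff measure of the boundary. Any minimiser, if it exists, is called a Cheeger set of $\Omega$. Sets are identified when they differ by a Lebesgue null set. A set $\Omega$ is called a minimal Cheeger set if it is the unique Cheeger set of itself (equivalently, it is minimal with respect to inclusion). *)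

(* Defs.v *)
From HB Require Import structures.
From mathcomp Require Import all_boot all_order all_algebra.
From mathcomp Require Import all_classical all_reals all_analysis.

Set Implicit Arguments.
Unset Strict Implicit.
Unset Printing Implicit Defensive.

Import Order.TTheory GRing.Theory Num.Theory.
Import numFieldTopology.Exports numFieldNormedType.Exports.

Local Open Scope classical_set_scope.
Local Open Scope ring_scope.

(* The measurable sets of a matrix space are its Borel sets. *)
HB.instance Definition _ (R : realType) (m n : nat) :=
  @isMeasurable.Build (sigma_display (@open 'M[R]_(m, n))) 'M[R]_(m, n)
    <<s @open 'M[R]_(m, n) >>
    (@sigma_algebra0 _ setT _) (@sigma_algebraC _ _)
    (@sigma_algebra_bigcup _ setT _).

Section borel_row_vectors.
Variable R : realType.

Definition rat_box n (q : 'rV[rat]_n * 'rV[rat]_n) : set 'rV[R]_n :=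
  [set x | forall i, ratr (q.1 0 i) < x 0 i < ratr (q.2 0 i)].

Lemma open_rat_boxE n (U : set 'rV[R]_n) : open U ->
  U = \bigcup_(q in [set q | rat_box q `<=` U]) rat_box q.
Proof.
move=> oU; apply/seteqP; split=> [x Ux|x [q /= qU qx]]; last exact: qU.
have /nbhs_ballP[e /= e0 eU] := open_nbhs_nbhs (conj oU Ux).
have ltq (y z : R) : y < z -> exists q : rat, y < ratr q < z.
  by move=> yz; have [q] := rat_in_itvoo yz; rewrite in_itv /=; exists q.
have [a Pa] : {a : 'I_n -> rat & forall i, x 0 i - e < ratr (a i) < x 0 i}.
  by apply: (@boolp.choice _ _ (fun i q => _ < ratr q < _)) => i; apply: ltq; rewrite ltrBlDr ltrDl.
have [b Pb] : {b : 'I_n -> rat & forall i, x 0 i < ratr (b i) < x 0 i + e}.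
  by apply: (@boolp.choice _ _ (fun i q => _ < ratr q < _)) => i; apply: ltq; rewrite ltrDl.
exists (\row_i a i, \row_i b i) => /=.
- move=> y yq; apply: eU; split => // i j; rewrite ord1.
  have := yq j; rewrite !mxE => /andP[ay yb].
  have /andP[ea _] := Pa j; have /andP[_ be] := Pb j.
  rewrite -ball_normE /ball_ /= ltr_distlC; apply/andP; split.
    exact: lt_trans ay.
  exact: lt_trans be.
- move=> i; rewrite !mxE.
  by have /andP[_ ->] := Pa i; have /andP[-> _] := Pb i.
Qed.

Lemma measurable_coord n (i : 'I_n) :
  measurable_fun setT (fun x : 'rV[R]_n => x 0 i).
Proof.
apply: (measurability _ (measurable_realfun.RGenOpens.measurableE R)).
move=> _ [_ [a [b ->] <-]]; rewrite setTI; apply: sub_sigma_algebra.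
by have /continuousP := @coord_continuous R 1 n 0 i; apply; exact: interval_open.
Qed.

Lemma measurable_rVP d (T : measurableType d) n (f : T -> 'rV[R]_n) :
  (forall i, measurable_fun setT (fun t => f t 0 i)) -> measurable_fun setT f.
Proof.
move=> mf; apply: (measurability (@open 'rV[R]_n)) => // _ [U oU <-].
rewrite setTI (open_rat_boxE oU) preimage_bigcup bigcup_mkcond.
apply: countable_bigcupT_measurable => [|q]; first exact: countableP.
case: ifPn => // _.
rewrite (_ : _ @^-1` _ = \bigcap_i
  ((fun t => f t 0 i) @^-1` `]ratr (q.1 0 i), ratr (q.2 0 i)[%classic)).
  apply: fin_bigcap_measurable => // i _.
  by rewrite -[X in measurable X]setTI; exact: mf.
apply/seteqP; split=> t /= qt i; first by move=> _; rewrite /= in_itv /=; exact: qt.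
by have /= := qt i Logic.I; rewrite in_itv.
Qed.

Definition rV_cons n (p : R * 'rV[R]_n) : 'rV[R]_n.+1 := row_mx p.1%:M p.2.

Definition rV_uncons n (x : 'rV[R]_n.+1) : R * 'rV[R]_n :=
  (x 0 0, \row_i x 0 (lift ord0 i)).

Lemma rV_consK n : cancel (@rV_cons n) (@rV_uncons n).
Proof.
move=> [a x]; congr pair.
  transitivity (row_mx (a%:M : 'M[R]_1) x 0 (lshift n 0)).
    by congr (row_mx _ _ _ _); exact/val_inj.
  by rewrite row_mxEl mxE.
apply/rowP => i; rewrite mxE.
have -> : lift ord0 i = rshift 1 i by exact/val_inj.
exact: row_mxEr.
Qed.

Lemma rV_cons0 n p : @rV_cons n p 0 0 = p.1.
Proof. by have [] := congr1 fst (rV_consK p). Qed.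

Lemma rV_consS n p (i : 'I_n) : @rV_cons n p 0 (lift ord0 i) = p.2 0 i.
Proof.
by have := congr1 (fun q : R * 'rV[R]_n => q.2 0 i) (rV_consK p); rewrite /= mxE.
Qed.

Lemma measurable_rV_cons n : measurable_fun setT (@rV_cons n).
Proof.
apply: measurable_rVP => i; case: (unliftP ord0 i) => [j|] ->.
  under eq_fun do rewrite rV_consS.
  exact: (measurableT_comp (measurable_coord j) measurable_snd).
under eq_fun do rewrite rV_cons0.
exact: measurable_fst.
Qed.

Lemma measurable_rV_uncons n : measurable_fun setT (@rV_uncons n).
Proof.
apply/measurable_fun_pairP; split; first exact: measurable_coord.
apply: measurable_rVP => i.
under eq_fun do rewrite /= mxE.
exact: measurable_coord.
Qed.

(* The product measure does not canonically unify as a sigma-finite measure, so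
   sigma-finiteness is established directly on the transported product. *)
Section step.
Variables (n : nat) (mu : {sigma_finite_measure set 'rV[R]_n -> \bar R}).

Definition lebesgue_step : set 'rV[R]_n.+1 -> \bar R :=
  pushforward (lebesgue_measure \x mu)%E (@rV_cons n).

Let mcons := @measurable_rV_cons n.

Let step0 : lebesgue_step set0 = 0%E.
Proof. by rewrite /lebesgue_step /pushforward preimage_set0 measure0. Qed.

Let step_ge0 A : (0 <= lebesgue_step A)%E.
Proof. exact: measure_ge0. Qed.

Let step_sigma_additive : semi_sigma_additive lebesgue_step.
Proof. exact: (@measure_semi_sigma_additive _ _ _ (pushforward _ _)). Qed.

HB.instance Definition _ :=
  isMeasure.Build _ _ _ lebesgue_step step0 step_ge0 step_sigma_additive.

Let step_sigma_finite : sigma_finite setT lebesgue_step.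
Proof.
have /sigma_finiteP[F [TF ndF Foo]] := sigma_finiteT (@lebesgue_measure R).
have /sigma_finiteP[G [TG ndG Goo]] := sigma_finiteT mu.
exists (fun k => @rV_uncons n @^-1` (F k `*` G k)).
  apply/esym; rewrite -subTset => x _.
  have [k _ Fk] : (\bigcup_k F k) (rV_uncons x).1 by rewrite -TF.
  have [l _ Gl] : (\bigcup_k G k) (rV_uncons x).2 by rewrite -TG.
  exists (maxn k l) => //; split => /=.
    by move: Fk; exact/subsetPset/ndF/leq_maxl.
  by move: Gl; exact/subsetPset/ndG/leq_maxr.
move=> k; have [mF Fk] := Foo k; have [mG Gk] := Goo k; split.
  rewrite -[X in measurable X]setTI; apply: measurable_rV_uncons => //.
  exact: measurableX.
rewrite /lebesgue_step /pushforward (_ : _ @^-1` _ = F k `*` G k); last first.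
  by rewrite -comp_preimage (_ : _ \o _ = id) ?preimage_id//; exact/funext/rV_consK.
by rewrite product_measure1E// lte_mul_pinfty// ge0_fin_numE.
Qed.

HB.instance Definition _ :=
  Measure_isSigmaFinite.Build _ _ _ lebesgue_step step_sigma_finite.

End step.

(* The Lebesgue measure on the Borel sets of R^n: the (n+1)-dimensional one is
   the product of the 1-dimensional and n-dimensional ones, transported along
   R * R^n ~ R^(n+1). See [lebesgue_rV_box]. *)
Fixpoint lebesgue_rV n : {sigma_finite_measure set 'rV[R]_n -> \bar R} :=
  match n with
  | 0 => \d_ (0 : 'rV[R]_0)
  | n.+1 => lebesgue_step (lebesgue_rV n)
  end.

Lemma measurable_rV_box n (a b : 'rV[R]_n) :
  measurable [set x : 'rV[R]_n | forall i, a 0 i < x 0 i <= b 0 i].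
Proof.
rewrite (_ : mkset _ = \bigcap_i
  ((fun x : 'rV[R]_n => x 0 i) @^-1` `]a 0 i, b 0 i]%classic)).
  apply: fin_bigcap_measurable => // i _.
  by rewrite -[X in measurable X]setTI; exact: measurable_coord.
apply/seteqP; split=> x /= xab i; first by move=> _; rewrite /= in_itv /=; exact: xab.
by have /= := xab i Logic.I; rewrite in_itv.
Qed.

Lemma lebesgue_rV_box n (a b : 'rV[R]_n) : (forall i, a 0 i <= b 0 i) ->
  lebesgue_rV n [set x : 'rV[R]_n | forall i, a 0 i < x 0 i <= b 0 i] =
  (\prod_i (b 0 i - a 0 i))%:E.
Proof.
elim: n a b => [|n IHn] a b ab.
  by rewrite big_ord0 /= diracE mem_set//; case.
have E : @rV_cons n @^-1` [set x : 'rV[R]_n.+1 | forall i, a 0 i < x 0 i <= b 0 i] =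
    `]a 0 0, b 0 0]%classic `*`
    [set x : 'rV[R]_n | forall i, (rV_uncons a).2 0 i < x 0 i <= (rV_uncons b).2 0 i].
  apply/seteqP; split=> [p /= pab|p [/= p1 p2] i].
    split=> [|i]; first by have := pab 0; rewrite rV_cons0 /= in_itv.
    by have := pab (lift ord0 i); rewrite rV_consS !mxE.
  case: (unliftP ord0 i) => [j|] ->.
    by have := p2 j; rewrite rV_consS !mxE.
  by move: p1; rewrite rV_cons0 in_itv.
rewrite -[LHS]/((lebesgue_measure \x lebesgue_rV n)%E (@rV_cons n @^-1` _)) E.
rewrite product_measure1E//; last exact: measurable_rV_box.
rewrite big_ord_recl EFinM; congr (_ * _)%E.
  rewrite [LHS]lebesgue_measure_itv /= lte_fin.
  by case: ltgtP (ab 0) => // ->; rewrite subrr.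
rewrite IHn => [|i]; last by rewrite !mxE.
by congr EFin; apply: eq_bigr => i _; rewrite !mxE.
Qed.

End borel_row_vectors.

Section cheeger.
Variables (R : realType) (n : nat).
Implicit Types (x : 'rV[R]_n) (phi : 'rV[R]_n -> 'rV[R]_n).
Implicit Types E S Omega : set 'rV[R]_n.

(* The library norm on row vectors is the sup norm. *)
Definition enorm x : R := Num.sqrt (\sum_i x 0 i ^+ 2).

Definition partial phi (i j : 'I_n) : 'rV[R]_n -> R :=
  'D_(delta_mx 0 i) (fun x => phi x 0 j).

Definition divergence phi x : R := \sum_i partial phi i i x.

Definition C1_field phi : Prop := forall i j,
  (forall x, derivable (fun y => phi y 0 j) x (delta_mx 0 i)) /\
  continuous (partial phi i j).

Definition test_field phi : Prop :=
  [/\ C1_field phi, compact (closure [set x | phi x != 0]) &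
      forall x, enorm (phi x) <= 1].

(* De Giorgi perimeter in the whole space. *)
Definition perimeter E : \bar R :=
  ereal_sup [set (\int[lebesgue_rV R n]_(x in E) (divergence phi x)%:E)%E
            | phi in test_field].

(* Positive measure forces [S] to be non-empty, and boundedness makes its
   measure finite. *)
Definition cheeger_admissible Omega S : Prop :=
  [/\ S `<=` Omega, measurable S, bounded_set S & (0 < lebesgue_rV R n S)%E].

Definition cheeger_quotient S : \bar R :=
  (perimeter S / lebesgue_rV R n S)%E.

Definition cheeger_constant Omega : \bar R :=
  ereal_inf [set cheeger_quotient S | S in cheeger_admissible Omega].

Definition cheeger_set Omega S : Prop :=
  cheeger_admissible Omega S /\ cheeger_quotient S = cheeger_constant Omega.

Definition minimal_cheeger_set Omega : Prop :=
  cheeger_set Omega Omega /\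
  forall S, cheeger_set Omega S -> lebesgue_rV R n (S `+` Omega) = 0%E.

Definition spherical_shell (a b : R) : set 'rV[R]_n :=
  [set x | a < enorm x < b].

End cheeger.

Arguments spherical_shell {R} n a b.

(* Main.v *)
(* Write q for the squared Euclidean norm and a = (R^(d-1) + r^(d-1)) / (R^d - r^d),
   so that the claimed constant is h = d a. The radial field
   Phi(x) = g(|x|) x / |x| with g(t) = a t + c t^(1-d) and c = R^(d-1) - a R^d has
   divergence h, and g increases from -1 at r to 1 at R: Phi calibrates the shell.

   Lower bound: extended by a cutoff, Phi / (1 + eps) is a test field, hence
   P(S) >= h |S| for every measurable S in the shell.

   Upper bound: let phi be a test field and eta a radial cutoff of the shell that
   varies only close to the two spheres, where |g| >= 1 / (1 + e). Then
   |grad eta| <= - (1 + e) grad eta . Phi, and integrating the divergence of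
   eta (phi - (1 + e) Phi) shows that the flux of phi is at most (1 + e) h |shell|
   in the limit. Phi thus replaces both surface measures and the scaling of volumes.

   Uniqueness: if P(S) = h |S| then, since |Phi| < 1 inside the shell, Phi can be
   perturbed by any small field compactly supported there, so the distributional
   gradient of the indicator of S vanishes in the open shell. Testing against
   tensor products shows that S has constant density on the sub-boxes of a small
   box, hence density 0 or 1 there, and the shell is connected as d >= 2. *)

Require Import Defs.
From mathcomp Require Import all_boot all_order all_algebra.
From mathcomp Require Import all_classical all_reals all_analysis.
From mathcomp Require Import measurable_realfun.
From mathcomp Require Import ring lra.
Import Order.TTheory GRing.Theory Num.Theory.
Import numFieldTopology.Exports numFieldNormedType.Exports.
Local Open Scope classical_set_scope.
Local Open Scope ring_scope.

Set Implicit Arguments.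
Unset Strict Implicit.
Unset Printing Implicit Defensive.

(** * One-variable C^1 functions *)

Section derivatives.
Context {K : realType}.

(** The radial fields g(|x|) x / |x| with constant divergence are the combinations of x and x /
    |x|^d; the two coefficients solve g(r) = -1, g(R) = 1, which makes the field the outer unit
    normal of the shell on both spheres.

    A Borel set has no boundary trace to integrate, so the only integration by parts used is that
    the divergence of a compactly supported C^1 field has integral 0; every boundary term has to
    come from a cutoff. Since test fields must be C^1, cutoffs are assembled from squares of
    positive parts, and radial functions are written in the squared norm q, a polynomial: the
    singularity of the norm at the origin then sits in one scalar coefficient, where a cutoff
    removes it.

    For uniqueness, the proportionality |Q| |E ∩ S| = |S ∩ Q| |E|, obtained for boxes E inside a
    small box Q, extends to Borel subsets E of Q because both sides are measures in E. Taking E = S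
    ∩ Q gives |Q| |S ∩ Q| = |S ∩ Q|^2, which leaves only the values 0 and |Q|. *)

Lemma derive_line (V : normedModType K) (f : V -> K) x v :
  'D_v f x = 'D_1 (fun h : K => f (h *: v + x)) 0.
Proof.
rewrite /derive; set g1 := fun h => h^-1 *: _; set g2 := fun h => h^-1 *: _.
suff -> : g1 = g2 by [].
by rewrite funeqE /g1 /g2 => h /=; rewrite addr0 scale0r add0r [_%:A]mulr1.
Qed.

(** Restriction to a line brings one-variable results to directional derivatives: the chain rule in
    [is_derive_comp], the mean value theorem in [lipschitz_partial], Fubini slices in
    [integral_partial_eq0]. *)
Lemma is_derive_line (V : normedModType K) (f : V -> K) x v df :
  is_derive x v f df <-> is_derive (0 : K) 1 (fun h : K => f (h *: v + x)) df.
Proof.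
split=> -[dfx <-].
  by apply: DeriveDef; [apply: (derivable1P f x v).1|rewrite (derive_line f)].
by apply: DeriveDef; [apply: (derivable1P f x v).2|rewrite (derive_line f)].
Qed.

Lemma is_derive_line_at (V : normedModType K) (f : V -> K) x v (t : K) df :
  is_derive (t *: v + x) v f df -> is_derive t 1 (fun h : K => f (h *: v + x)) df.
Proof.
move=> /is_derive_line fd; apply/is_derive_line.
by under eq_fun do rewrite [_%:A]mulr1 scalerDl -addrA.
Qed.

Lemma is_derive_mul (V : normedModType K) (f g : V -> K) x v df dg :
  is_derive x v f df -> is_derive x v g dg ->
  is_derive x v (fun y => f y * g y) (df * g x + f x * dg).
Proof.
move=> fd gd; have := is_deriveM fd gd.
by move/is_derive_eq; apply; rewrite addrC [g x *: _]mulrC.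
Qed.

Lemma is_derive_add (V : normedModType K) (f g : V -> K) x v df dg :
  is_derive x v f df -> is_derive x v g dg ->
  is_derive x v (fun y => f y + g y) (df + dg).
Proof. by move=> fd gd; exact: is_deriveD. Qed.

Lemma is_derive_const (V : normedModType K) (a : K) (x v : V) :
  is_derive x v (fun=> a) 0.
Proof. exact: is_derive_cst. Qed.

Lemma is_derive_scale (V : normedModType K) (f : V -> K) x v df a :
  is_derive x v f df -> is_derive x v (fun y => a * f y) (a * df).
Proof.
move=> fd; have := is_derive_mul (is_derive_const a x v) fd.
by rewrite mul0r add0r.
Qed.

Lemma is_derive_opp (V : normedModType K) (f : V -> K) x v df :
  is_derive x v f df -> is_derive x v (fun y => - f y) (- df).
Proof. by move=> fd; exact: is_deriveN. Qed.

Lemma is_derive_bigsum (V : normedModType K) m (f : 'I_m -> V -> K) x v df :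
  (forall i, is_derive x v (f i) (df i)) ->
  is_derive x v (fun y => \sum_i f i y) (\sum_i df i).
Proof.
move=> fd; have := is_derive_sum fd.
rewrite [X in is_derive _ _ X](_ : _ = (fun y => \sum_i f i y)) //.
by apply/funext => y; rewrite fct_sumE.
Qed.

Lemma is_derive_comp (V : normedModType K) (e : K -> K) (f : V -> K) x v de df :
  is_derive (f x) 1 e de -> is_derive x v f df ->
  is_derive x v (fun y => e (f y)) (de * df).
Proof.
move=> ed /is_derive_line fd; apply/is_derive_line.
apply: (@is_derive1_comp K e (fun h => f (h *: v + x))) => //.
by rewrite scale0r add0r.
Qed.

Lemma is_derive_affine (a b t : K) : is_derive t 1 (fun s => a * s + b) a.
Proof.
have := is_derive_add (is_derive_scale a (is_derive_id t 1))
  (is_derive_const b t 1).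
by rewrite addr0 mulr1.
Qed.

(** The derivative is carried as data, so that the closure lemmas compute it and divergences come
    out as explicit formulas. *)
Definition C1_real (f f' : K -> K) : Prop :=
  (forall t : K, is_derive t 1 f (f' t)) /\ continuous f'.

Lemma is_derive_continuous (f f' : K -> K) :
  (forall t : K, is_derive t 1 f (f' t)) -> continuous f.
Proof.
move=> fd t; apply/differentiable_continuous/derivable1_diffP.
by have [] := fd t.
Qed.

Lemma C1_real_continuous f f' : C1_real f f' -> continuous f.
Proof. by case=> + _; exact: is_derive_continuous. Qed.

Lemma C1_real_mul f f' g g' : C1_real f f' -> C1_real g g' ->
  C1_real (fun t => f t * g t) (fun t => f' t * g t + f t * g' t).
Proof.
move=> fC gC; have cf := C1_real_continuous fC; have cg := C1_real_continuous gC.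
case: fC gC => [fd cf'] [gd cg']; split=> [t|t].
  exact: is_derive_mul.
by apply: cvgD; apply: cvgM; [exact: cf'|exact: cg|exact: cf|exact: cg'].
Qed.

Lemma C1_real_comp f f' g g' : C1_real f f' -> C1_real g g' ->
  C1_real (fun t => f (g t)) (fun t => f' (g t) * g' t).
Proof.
move=> fC gC; have cg := C1_real_continuous gC.
case: fC gC => [fd cf'] [gd cg']; split=> [t|t].
  exact: is_derive_comp.
by apply: cvgM; [apply: (continuous_comp (cg t)); exact: cf'|exact: cg'].
Qed.

Lemma C1_real_add f f' g g' : C1_real f f' -> C1_real g g' ->
  C1_real (fun t => f t + g t) (fun t => f' t + g' t).
Proof.
case=> [fd cf'] [gd cg']; split=> [t|t]; first exact: is_derive_add.
by apply: cvgD; [exact: cf'|exact: cg'].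
Qed.

Lemma C1_real_affine (a b : K) : C1_real (fun s => a * s + b) (fun=> a).
Proof. by split=> t; [exact: is_derive_affine|exact: cvg_cst]. Qed.

Lemma C1_real_scale a f f' : C1_real f f' ->
  C1_real (fun t => a * f t) (fun t => a * f' t).
Proof.
case=> fd cf'; split=> [t|t]; first exact: is_derive_scale.
by apply: cvgM; [exact: cvg_cst|exact: cf'].
Qed.

Lemma C1_real_opp f f' : C1_real f f' ->
  C1_real (fun t => - f t) (fun t => - f' t).
Proof.
case=> fd cf'; split=> [t|t]; first exact: is_derive_opp.
by apply: cvgN; exact: cf'.
Qed.

(** Squaring smooths the corner of the positive part just enough: the derivative is continuous,
    which is all that test fields require. *)
Definition sqpos (t : K) : K := Num.max 0 t ^+ 2.

Lemma is_derive_sqpos (t : K) : is_derive t 1 sqpos (2 * Num.max 0 t).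
Proof.
have [t0|t0|<-] := ltgtP 0 t.
- apply: (@near_eq_is_derive K K K (fun s => s * s)).
    have : \forall s \near t, 0 < s by apply: lt_nbhsr.
    by apply: filterS => s s0; rewrite /sqpos max_r ?ltW// expr2.
  have := @is_derive_mul K id id t 1 1 1 (is_derive_id t 1) (is_derive_id t 1).
  by move/is_derive_eq; apply=> /=; ring.
- apply: (@near_eq_is_derive K K K (fun=> 0)).
    have : \forall s \near t, s < 0 by apply: lt_nbhsl.
    by apply: filterS => s s0; rewrite /sqpos max_l ?ltW// expr0n.
  by rewrite mulr0; exact: is_derive_const.
- rewrite ?maxxx mulr0.
  have h0 : (fun h : K => h^-1 *: (sqpos (h *: 1 + 0) - sqpos 0))
      @ 0^' --> (0 : K).
    apply/cvgrPdist_le => e e0; near=> h.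
    rewrite sub0r normrN addr0 [_%:A]mulr1 /sqpos maxxx expr0n subr0.
    have hn0 : h != 0 by near: h; exact: nbhs_dnbhs_neq.
    rewrite [_ *: _]mulrC normrM normrV ?unitfE// ler_pdivrMr ?normr_gt0//.
    have he : `|h| <= e by near: h; apply: dnbhs0_le.
    rewrite normrX expr2; apply: ler_pM => //.
      by apply: le_trans he; have [h0|h0] := leP 0 h; rewrite ?normr0.
    by have [h0|h0] := leP 0 h; rewrite ?normr0.
  by apply: DeriveDef; [apply/cvg_ex; exists 0|exact: cvg_lim].
Unshelve. all: by end_near. Qed.

Lemma continuous_pospart : continuous (fun t : K => Num.max 0 t).
Proof.
move=> t; apply: (@continuous_max K K (fun=> 0) id); first exact: cvg_cst.
exact: cvg_id.
Qed.

Lemma C1_sqpos : C1_real sqpos (fun t => 2 * Num.max 0 t).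
Proof.
split=> t; first exact: is_derive_sqpos.
by apply: cvgM; [exact: cvg_cst|exact: continuous_pospart].
Qed.

(** A nondecreasing C^1 transition from 0 on [t <= 0] to 1 on [1 <= t]. As a composite of [sqpos]
    with affine maps it needs no case analysis at the junctions 0 and 1. *)
Definition smoothstep (t : K) : K := 1 - sqpos (1 - sqpos t).
Definition smoothstep' (t : K) : K :=
  4 * (Num.max 0 (1 - sqpos t) * Num.max 0 t).

Lemma C1_smoothstep : C1_real smoothstep smoothstep'.
Proof.
have C1_onem (f f' : K -> K) : C1_real f f' ->
    C1_real (fun t => 1 - f t) (fun t => - f' t).
  move=> /C1_real_opp/(C1_real_add (C1_real_affine 0 1)).
  by congr C1_real; apply/funext => t; rewrite /= ?mul0r add0r.
have := C1_onem _ _ (C1_real_comp C1_sqpos (C1_onem _ _ C1_sqpos)).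
by congr C1_real; apply/funext => t; rewrite /smoothstep'/=; ring.
Qed.

Lemma smoothstep_eq0 t : t <= 0 -> smoothstep t = 0.
Proof.
move=> t0; rewrite /smoothstep /sqpos (max_l t0) expr0n subr0 max_r//.
by rewrite expr1n subrr.
Qed.

Lemma smoothstep_eq1 t : 1 <= t -> smoothstep t = 1.
Proof.
move=> t1; have t0 : 0 <= t by exact: le_trans t1.
rewrite /smoothstep /sqpos (max_r t0) max_l ?expr0n ?subr0// subr_le0.
by rewrite exprn_ege1.
Qed.

Lemma smoothstep_itv t : 0 <= smoothstep t <= 1.
Proof.
rewrite /smoothstep /sqpos subr_ge0 gerBl sqr_ge0 andbT.
apply: exprn_ile1; first by rewrite le_max lexx.
by rewrite ge_max ler01 gerBl sqr_ge0.
Qed.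

Lemma smoothstep'_ge0 t : 0 <= smoothstep' t.
Proof. by rewrite /smoothstep' !mulr_ge0// le_max lexx. Qed.

Lemma smoothstep'_eq0 t : (t <= 0) || (1 <= t) -> smoothstep' t = 0.
Proof.
case/orP=> t1; rewrite /smoothstep'; first by rewrite (max_l t1) !mulr0.
rewrite max_l ?mul0r ?mulr0// /sqpos subr_le0 max_r ?exprn_ege1//.
exact: le_trans t1.
Qed.

End derivatives.

(** * Continuous functions on row vectors *)

Section continuous_functions.
Context {K : realType}.

Lemma open_measurable_rV n (U : set 'rV[K]_n) : open U -> measurable U.
Proof. by move=> oU; exact: sub_sigma_algebra. Qed.

Lemma continuous_measurable_rV n (f : 'rV[K]_n -> K) :
  continuous f -> measurable_fun setT f.
Proof.
move=> /continuousP cf.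
apply: (measurability _ (RGenOpens.measurableE K)).
move=> _ [_ [a [b ->] <-]]; rewrite setTI; apply: open_measurable_rV.
by apply: cf; exact: interval_open.
Qed.

Lemma continuous_rV n (T : topologicalType) (f : T -> 'rV[K]_n) :
  (forall i, continuous (fun t => f t 0 i)) -> continuous f.
Proof.
move=> cf t; apply/cvg_ballP => e e0; near=> s.
split=> // i j; rewrite ord1; move: j; near: s.
apply: filter_forall => j.
by have /cvg_ballP/(_ _ e0) := cf j t.
Unshelve. all: by end_near. Qed.

(** Supports are bounded by coordinate cubes because a slice of a cube along a coordinate lies in
    the cube of the same size one dimension lower, as the Fubini induction requires. *)
Definition cube n (M : K) : set 'rV[K]_n := [set x | forall j, `|x 0 j| <= M].

Lemma compact_cube n M : compact (@cube n M).
Proof.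
have -> : @cube n M = [set x | forall j, `[- M, M]%classic (x ord0 j)].
  by apply/seteqP; split=> x /= xM j; have := xM j; rewrite ?in_itv/= -ler_norml.
by apply: (rV_compact (fun=> @segment_compact K (- M) M)).
Qed.

Lemma measurable_cube n M : measurable (@cube n M).
Proof.
have cl : closed (@cube n M).
  by apply: compact_closed; [exact: norm_hausdorff|exact: compact_cube].
rewrite -[X in measurable X]setCK; apply: measurableC.
by apply: open_measurable_rV; exact: closed_openC.
Qed.

Lemma lebesgue_rV_cube_fin n M : (lebesgue_rV K n (@cube n M) < +oo)%E.
Proof.
(* The box is half open and [M] may be negative: [|M| + 1] gives a strict lower bound and a
   correctly oriented box in all cases. *)
pose a : 'rV[K]_n := \row_i (- (`|M| + 1)).
pose b : 'rV[K]_n := \row_i (`|M| + 1).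
have M0 : 0 < `|M| + 1 by rewrite ltr_pwDr.
have ab i : a 0 i <= b 0 i by rewrite !mxE ge0_cp// ltW.
apply: (@le_lt_trans _ _ (lebesgue_rV K n
    [set x : 'rV[K]_n | forall i, a 0 i < x 0 i <= b 0 i])); last first.
  by rewrite (lebesgue_rV_box ab) ltry.
apply: le_measure; rewrite ?inE; [exact: measurable_cube|exact: measurable_rV_box|].
move=> x xM i; rewrite !mxE; have := xM i; have := ler_norm M.
by rewrite ler_norml => h /andP[h1 h2]; apply/andP; split; lra.
Qed.

Lemma bounded_on_cube n (g : 'rV[K]_n -> K) M : continuous g ->
  exists2 C, 0 <= C & forall x, cube M x -> `|g x| <= C.
Proof.
move=> cg.
have : compact (g @` cube M).
  by apply: continuous_compact; [exact: continuous_subspaceT|exact: compact_cube].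
move=> /compact_bounded /pinfty_ex_gt0[C C0 gC]; exists C; first exact: ltW.
by move=> x Mx; apply: gC; exists x.
Qed.

Lemma integrable_cube n (D : set 'rV[K]_n) (g : 'rV[K]_n -> K) M : measurable D ->
  continuous g -> D `<=` cube M ->
  (lebesgue_rV K n).-integrable D (EFin \o g).
Proof.
move=> mD cg DM; have [C C0 gC] := bounded_on_cube M cg.
apply: measurable_bounded_integrable => //.
- apply: le_lt_trans (lebesgue_rV_cube_fin n M); apply: le_measure => //.
    by rewrite inE.
  by rewrite inE; exact: measurable_cube.
- by apply: measurable_funTS; exact: continuous_measurable_rV.
- exists C; split; first exact: ger0_real.
  by move=> B CB x /DM /gC /le_trans; apply; exact: ltW.
Qed.

Lemma integrable_cube_support n (g : 'rV[K]_n -> K) M :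
  continuous g -> (forall x, g x != 0 -> cube M x) ->
  (lebesgue_rV K n).-integrable setT (EFin \o g).
Proof.
move=> cg gM.
have -> : EFin \o g = (EFin \o g) \_ (cube M).
  apply/funext => x; rewrite /patch; case: ifPn => // /negP xM /=.
  have [->//|/gM] := eqVneq (g x) 0.
  by move=> /mem_set.
apply/(integrable_mkcond _ (@measurable_cube n M)).
by apply: (integrable_cube (M := M)) => //; exact: measurable_cube.
Qed.

(** Cubes are closed: [f] vanishes near any point outside, hence so does its derivative at that
    point. *)
Lemma partial_cube n (f g : 'rV[K]_n -> K) (i : 'I_n) M :
  (forall x, is_derive x (delta_mx 0 i) f (g x)) ->
  (forall x, f x != 0 -> cube M x) -> forall x, g x != 0 -> cube M x.
Proof.
move=> fg fM x gx0 j; rewrite leNgt; apply/negP => Mx; move/negP: gx0; apply.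
have [_ <-] := fg x; apply/eqP.
rewrite -[RHS](derive_cst (0 : K) x (delta_mx 0 i)); apply: near_eq_derive.
have cn : continuous (fun y : 'rV[K]_n => `|y 0 j|).
  move=> y; apply: (continuous_comp (@coord_continuous K 1 n 0 j y)).
  exact: norm_continuous.
have : \forall y \near x, M < `|(y : 'rV[K]_n) 0 j|.
  exact: (cn x _ (lt_nbhsr Mx)).
apply: filterS => y My; apply/eqP; apply: contraTT My => /fM/(_ j).
by rewrite -leNgt.
Qed.

End continuous_functions.

(** * Integrals of partial derivatives *)

Section divergence_theorem.
Context {K : realType}.

Lemma integral_derive_eq0 (f f' : K -> K) (M : K) : C1_real f f' ->
  (forall t, f t != 0 -> `|t| <= M) ->
  (\int[lebesgue_measure]_t (f' t)%:E = 0)%E.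
Proof.
move=> [fd cf'] fM.
have f'M t : f' t != 0 -> `|t| <= M.
  move=> f't; rewrite leNgt; apply/negP => Mt; move/negP: f't; apply.
  have [_ <-] := fd t; apply/eqP.
  rewrite -[RHS](derive_cst (0 : K) t (1 : K)); apply: near_eq_derive.
  have : \forall s \near t, M < `|s|.
    exact: (@norm_continuous _ K t _ (lt_nbhsr Mt)).
  by apply: filterS => s Ms; apply/eqP; apply: contraTT Ms => /fM; rewrite -leNgt.
(* Strictly above [M], so that [f] vanishes at both ends of the interval of integration. *)
pose N := `|M| + 1.
have MN : M < N by rewrite ltr_pwDr// ler_norm.
have N0 : 0 < N by rewrite ltr_pwDr.
have fN t : N <= `|t| -> f t = 0.
  by move=> Nt; apply/eqP; apply: contraTT (lt_le_trans MN Nt) => /fM; rewrite -leNgt.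
transitivity (\int[lebesgue_measure]_(t in `[(- N)%R, N]) (f' t)%:E)%E.
  rewrite [RHS]integral_mkcond; apply: eq_integral => t _.
  rewrite /patch; case: ifPn => // /negP tN.
  have [->//|/f'M tM] := eqVneq (f' t) 0.
  by exfalso; apply: tN; rewrite inE/= in_itv/= -ler_norml (le_trans tM)// ltW.
have cf := is_derive_continuous fd.
rewrite (@continuous_FTC2 _ f' f).
- by rewrite !fN ?subee// ?normrN ler_norm.
- by rewrite gtrN.
- exact: continuous_subspaceT.
- split=> [t _||]; first by have [] := fd t.
  + by apply: cvg_at_right_filter; exact: cf.
  + by apply: cvg_at_left_filter; exact: cf.
- by move=> t _; rewrite derive1E; have [_ ->] := fd t.
Qed.

Lemma rV_cons_addZ n (h : K) (p q : K * 'rV[K]_n) :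
  h *: rV_cons p + rV_cons q = rV_cons (h * p.1 + q.1, h *: p.2 + q.2).
Proof.
apply/rowP => i; rewrite mxE [X in X + _]mxE.
case: (unliftP ord0 i) => [j|] ->; last by rewrite !rV_cons0.
by rewrite !rV_consS !mxE.
Qed.

Lemma delta_rV_cons0 n :
  delta_mx 0 ord0 = rV_cons (1, 0) :> 'rV[K]_n.+1.
Proof.
apply/rowP => i; rewrite mxE; case: (unliftP ord0 i) => [j|] ->.
  by rewrite rV_consS mxE.
by rewrite rV_cons0.
Qed.

Lemma delta_rV_consS n (i : 'I_n) :
  delta_mx 0 (lift ord0 i) = rV_cons (0, delta_mx 0 i) :> 'rV[K]_n.+1.
Proof.
apply/rowP => j; rewrite mxE; case: (unliftP ord0 j) => [k|] ->.
  by rewrite rV_consS mxE (inj_eq lift_inj).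
by rewrite rV_cons0.
Qed.

Lemma continuous_rV_cons_l n (y : 'rV[K]_n) :
  continuous (fun t : K => rV_cons (t, y)).
Proof.
apply: continuous_rV => i; case: (unliftP ord0 i) => [j|] ->.
  by under eq_fun do rewrite rV_consS; exact: cst_continuous.
by under eq_fun do rewrite rV_cons0; move=> t; exact: cvg_id.
Qed.

Lemma continuous_rV_cons_r n (t : K) :
  continuous (fun y : 'rV[K]_n => rV_cons (t, y)).
Proof.
apply: continuous_rV => i; case: (unliftP ord0 i) => [j|] ->.
  by under eq_fun do rewrite rV_consS; exact: coord_continuous.
by under eq_fun do rewrite rV_cons0; exact: cst_continuous.
Qed.

(* [lebesgue_measure] lives on [measurableTypeR K] rather than on [K]; spelling
   the types out keeps unification from unfolding the product measure. *)
Let prod_measure n : {measure set (measurableTypeR K * 'rV[K]_n) -> \bar K} :=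
  (lebesgue_measure \x lebesgue_rV K n)%E.

Let cons n : measurableTypeR K * 'rV[K]_n -> 'rV[K]_n.+1 := @rV_cons K n.

Let measurable_cons n : measurable_fun setT (@cons n).
Proof. exact: measurable_rV_cons. Qed.

(** [lebesgue_rV K n.+1] is convertible to the pushforward of the product measure along [rV_cons];
    both [by []] below rest on this. *)
Lemma integral_rV_cons n (g : 'rV[K]_n.+1 -> K) : measurable_fun setT g ->
  (lebesgue_rV K n.+1).-integrable setT (EFin \o g) ->
  (lebesgue_measure \x lebesgue_rV K n)%E.-integrable setT
    (fun p : measurableTypeR K * 'rV[K]_n => (g (rV_cons p))%:E) /\
  (\int[lebesgue_rV K n.+1]_x (g x)%:E =
   \int[lebesgue_measure \x lebesgue_rV K n]_p (g (rV_cons p))%:E)%E.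
Proof.
move=> mg0 ig; have mg := (measurable_EFinP _ _).2 mg0.
have ic : (@prod_measure n).-integrable setT ((EFin \o g) \o @cons n).
  apply/integrableP; split.
    apply/measurable_EFinP.
    exact: (measurableT_comp mg0 (@measurable_cons n)).
  have /integrableP[_] := ig; congr (_ < _)%E.
  transitivity (\int[pushforward (@prod_measure n) (@cons n)]_x `|(g x)%:E|)%E.
    by [].
  rewrite (ge0_integral_pushforward (@measurable_cons n))//.
  apply/(measurable_EFinP _ (fun y => `|g y|)).
  exact: (measurableT_comp (@normr_measurable K setT) mg0).
split=> //.
transitivity (\int[pushforward (@prod_measure n) (@cons n)]_x (g x)%:E)%E.
  by [].
by rewrite (integral_pushforward (@measurable_cons n) mg ic).
Qed.

(** Fubini with the inner integral chosen to contain direction [i]: the first coordinate is settled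
    by the fundamental theorem of calculus, a later one by induction on the remaining
    coordinates. *)
Lemma integral_partial_eq0 n (f g : 'rV[K]_n -> K) (i : 'I_n) (M : K) :
  (forall x, is_derive x (delta_mx 0 i) f (g x)) -> continuous g ->
  (forall x, f x != 0 -> cube M x) ->
  (\int[lebesgue_rV K n]_x (g x)%:E = 0)%E.
Proof.
elim: n f g i => [|n IHn] f g i; first by case: i.
move=> fg cg fM; have gM := partial_cube fg fM.
have [ip ->] := integral_rV_cons (continuous_measurable_rV cg)
  (integrable_cube_support cg gM).
case: (unliftP ord0 i) fg => [j ->|->] fg.
- rewrite -(integral12_prod_meas1 ip).
  apply: integral0_eq => t _.
  apply: (IHn (fun y => f (rV_cons (t, y))) _ j).
  + move=> y; apply/is_derive_line.
    have := (is_derive_line _ _ _ _).1 (fg (rV_cons (t, y))).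
    by under eq_fun do rewrite delta_rV_consS rV_cons_addZ/= mulr0 add0r.
  + move=> y; apply: (continuous_comp (@continuous_rV_cons_r n t y)).
    exact: cg.
  + by move=> y /fM yM k; have := yM (lift ord0 k); rewrite rV_consS.
- rewrite -(integral21_prod_meas1 ip).
  apply: integral0_eq => y _.
  apply: (@integral_derive_eq0 (fun t => f (rV_cons (t, y))) _ M).
    split=> [t|t].
      apply/is_derive_line.
      have := (is_derive_line _ _ _ _).1 (fg (rV_cons (t, y))).
      under eq_fun do rewrite delta_rV_cons0 rV_cons_addZ/= mulr1 scaler0 add0r.
      by under [in X in _ -> X]eq_fun do rewrite [_%:A]mulr1.
    apply: (continuous_comp (@continuous_rV_cons_l n y t)).
    exact: cg.
  by move=> t /fM/(_ ord0); rewrite rV_cons0.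
Qed.

End divergence_theorem.

(** * C^1 vector fields *)

Section fields.
Context {K : realType} {n : nat}.
Implicit Types (x y : 'rV[K]_n) (phi : 'rV[K]_n -> 'rV[K]_n).

Definition sqn x : K := \sum_i x 0 i ^+ 2.

Lemma continuous_bigsum m (u : 'I_m -> 'rV[K]_n -> K) :
  (forall k, continuous (u k)) -> continuous (fun x => \sum_k u k x).
Proof. by move=> cu; apply: continuous_big => //; exact: add_continuous. Qed.

(** Continuity of [u] is a clause of its own because the product and chain rules use it to keep
    partial derivatives continuous; for test fields it is recovered by [continuous_partial]. *)
Definition C1_scalar (u : 'rV[K]_n -> K) (Du : 'I_n -> 'rV[K]_n -> K) : Prop :=
  continuous u /\
  forall i, (forall x, is_derive x (delta_mx 0 i) u (Du i x)) /\ continuous (Du i).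

Lemma sqn_ge0 x : 0 <= sqn x.
Proof. by apply: sumr_ge0 => i _; exact: sqr_ge0. Qed.

Lemma sqr_enorm x : enorm x ^+ 2 = sqn x.
Proof. by rewrite sqr_sqrtr// sqn_ge0. Qed.

Lemma continuous_coord (j : 'I_n) : continuous (fun x => x 0 j).
Proof. exact: coord_continuous. Qed.

Lemma C1_scalar_mul u Du v Dv : C1_scalar u Du -> C1_scalar v Dv ->
  C1_scalar (fun x => u x * v x) (fun i x => Du i x * v x + u x * Dv i x).
Proof.
move=> [cu dDu] [cv dDv]; split=> [x|i]; first exact: (cvgM (cu x) (cv x)).
have [[du cDu] [dv cDv]] := (dDu i, dDv i); split=> x; first exact: is_derive_mul.
exact: (cvgD (cvgM (cDu x) (cv x)) (cvgM (cu x) (cDv x))).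
Qed.

Lemma C1_scalar_add u Du v Dv : C1_scalar u Du -> C1_scalar v Dv ->
  C1_scalar (fun x => u x + v x) (fun i x => Du i x + Dv i x).
Proof.
move=> [cu dDu] [cv dDv]; split=> [x|i]; first exact: (cvgD (cu x) (cv x)).
have [[du cDu] [dv cDv]] := (dDu i, dDv i); split=> x; first exact: is_derive_add.
exact: (cvgD (cDu x) (cDv x)).
Qed.

Lemma C1_scalar_const a : C1_scalar (fun=> a) (fun _ _ => 0).
Proof.
split=> [|i]; first exact: cst_continuous.
by split=> [x|]; [exact: is_derive_const|exact: cst_continuous].
Qed.

Lemma C1_scalar_scale a u Du : C1_scalar u Du ->
  C1_scalar (fun x => a * u x) (fun i x => a * Du i x).
Proof.
move=> /(C1_scalar_mul (C1_scalar_const a)); congr C1_scalar.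
by apply/funext => i; apply/funext => x; rewrite mul0r add0r.
Qed.

Lemma C1_scalar_comp (f f' : K -> K) u Du : C1_real f f' -> C1_scalar u Du ->
  C1_scalar (fun x => f (u x)) (fun i x => f' (u x) * Du i x).
Proof.
move=> fC [cu dDu]; have cf := C1_real_continuous fC; have [fd cf'] := fC.
split=> [x|i]; first exact: (continuous_comp (cu x) (cf _)).
have [du cDu] := dDu i; split=> x; first exact: is_derive_comp.
exact: (cvgM (continuous_comp (cu x) (cf' _)) (cDu x)).
Qed.

Lemma C1_scalar_coord (j : 'I_n) : C1_scalar (fun x => x 0 j) (fun i _ => (i == j)%:R).
Proof.
split=> [|i]; first exact: continuous_coord.
split=> [x|]; last exact: cst_continuous.
apply/is_derive_line; have := is_derive_affine (i == j)%:R (x 0 j) 0.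
rewrite [X in is_derive _ _ X](_ : _ = fun h : K => (h *: delta_mx 0 i + x) 0 j)//.
by apply/funext => h; rewrite !mxE eqxx/= mulrC eq_sym.
Qed.

Lemma C1_scalar_bigsum m (u : 'I_m -> 'rV[K]_n -> K) Du :
  (forall k, C1_scalar (u k) (Du k)) ->
  C1_scalar (fun x => \sum_k u k x) (fun i x => \sum_k Du k i x).
Proof.
move=> uD; split=> [|i]; first by apply: continuous_bigsum => k; have [] := uD k.
split=> [x|]; first by apply: is_derive_bigsum => k; have [_ /(_ i)[]] := uD k.
by apply: continuous_bigsum => k; have [_ /(_ i)[]] := uD k.
Qed.

Lemma C1_scalar_sqn : C1_scalar sqn (fun i x => 2 * x 0 i).
Proof.
have := C1_scalar_bigsum (fun k => C1_scalar_mul (C1_scalar_coord k) (C1_scalar_coord k)).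
congr C1_scalar.
apply/funext => i; apply/funext => x; rewrite (bigD1 i)//= eqxx mul1r mulr1.
rewrite big1 ?addr0 => [|k ki]; first by ring.
by rewrite eq_sym (negbTE ki) mul0r mulr0 addr0.
Qed.

(** [D i j] is the derivative of component [j] in direction [i], the index order of [partial]. *)
Definition C1_vector phi (D : 'I_n -> 'I_n -> 'rV[K]_n -> K) : Prop :=
  forall j, C1_scalar (fun x => phi x 0 j) (D^~ j).

Lemma C1_vectorP phi D : C1_vector phi D -> C1_field phi.
Proof.
move=> phiD i j; have [_ /(_ i)[d cD]] := phiD j.
split=> [x|]; first by have [] := d x.
by rewrite (_ : partial phi i j = D i j)//; apply/funext => x; have [_] := d x.
Qed.

Lemma divergenceE phi D x : C1_vector phi D ->
  divergence phi x = \sum_i D i i x.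
Proof.
by move=> phiD; apply: eq_bigr => i _; have [_ /(_ i)[/(_ x)[]]] := phiD i.
Qed.

Lemma continuous_divergence phi : C1_field phi -> continuous (divergence phi).
Proof. by move=> C; apply: continuous_bigsum => i; have [] := C i i. Qed.

Lemma C1_vector_scale u Du phi D : C1_scalar u Du -> C1_vector phi D ->
  C1_vector (fun x => u x *: phi x)
    (fun i j x => Du i x * phi x 0 j + u x * D i j x).
Proof.
move=> uD phiD j; have := C1_scalar_mul uD (phiD j).
by congr C1_scalar; apply/funext => x; rewrite mxE.
Qed.

Lemma C1_vector_add phi D psi E : C1_vector phi D -> C1_vector psi E ->
  C1_vector (fun x => phi x + psi x) (fun i j x => D i j x + E i j x).
Proof.
move=> phiD psiE j; have := C1_scalar_add (phiD j) (psiE j).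
by congr C1_scalar; apply/funext => x; rewrite mxE.
Qed.

Lemma C1_vector_id : C1_vector id (fun i j _ => (i == j)%:R).
Proof. exact: C1_scalar_coord. Qed.

Lemma C1_vector_delta u Du (k : 'I_n) : C1_scalar u Du ->
  C1_vector (fun x => u x *: delta_mx 0 k) (fun i j x => Du i x * (j == k)%:R).
Proof.
move=> uD j; have := C1_scalar_mul uD (C1_scalar_const (j == k)%:R).
congr C1_scalar; first by apply/funext => x; rewrite !mxE eqxx.
by apply/funext => i; apply/funext => x; rewrite mulr0 addr0.
Qed.

Lemma divergence_scale u Du phi x : C1_scalar u Du -> (exists D, C1_vector phi D) ->
  divergence (fun y => u y *: phi y) x =
  \sum_i Du i x * phi x 0 i + u x * divergence phi x.
Proof.
move=> uD [D phiD]; rewrite (divergenceE x (C1_vector_scale uD phiD)).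
by rewrite (divergenceE x phiD) big_split/= mulr_sumr.
Qed.

Lemma divergence_add phi psi x : (exists D, C1_vector phi D) ->
  (exists D, C1_vector psi D) ->
  divergence (fun y => phi y + psi y) x = divergence phi x + divergence psi x.
Proof.
move=> [D phiD] [E psiE]; rewrite (divergenceE x (C1_vector_add phiD psiE)).
by rewrite (divergenceE x phiD) (divergenceE x psiE) big_split.
Qed.

Lemma divergence_delta u Du (k : 'I_n) x : C1_scalar u Du ->
  divergence (fun y => u y *: delta_mx 0 k) x = Du k x.
Proof.
move=> uD; rewrite (divergenceE x (C1_vector_delta k uD)) (bigD1 k)//= eqxx mulr1.
by rewrite big1 ?addr0// => i ik; rewrite (negbTE ik) mulr0.
Qed.

Lemma divergence_id x : divergence id x = n%:R :> K.
Proof.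
rewrite (divergenceE x C1_vector_id); under eq_bigr do rewrite eqxx.
by rewrite sumr_const card_ord.
Qed.

Lemma C1_scalar_radial f f' : C1_real f f' ->
  C1_scalar (fun x => f (sqn x)) (fun i x => f' (sqn x) * (2 * x 0 i)).
Proof. by move=> fC; exact: (C1_scalar_comp fC C1_scalar_sqn). Qed.

Lemma divergence_radial f f' x : C1_real f f' ->
  divergence (fun y => f (sqn y) *: y) x =
  2 * sqn x * f' (sqn x) + n%:R * f (sqn x).
Proof.
move=> fC; rewrite (divergence_scale x (C1_scalar_radial fC)); last first.
  by eexists; exact: C1_vector_id.
rewrite divergence_id [n%:R * _]mulrC; congr (_ + _).
by rewrite /sqn mulr_sumr mulr_suml; apply: eq_bigr => i _; ring.
Qed.

Lemma integral_divergence_eq0 phi D M : C1_vector phi D ->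
  (forall x, phi x != 0 -> cube M x) ->
  (\int[lebesgue_rV K n]_x (divergence phi x)%:E = 0)%E.
Proof.
move=> phiD phiM; under eq_integral do rewrite (divergenceE _ phiD) -sumEFin.
have phiiM i x : phi x 0 i != 0 -> cube M x.
  by move=> phix; apply: phiM; apply: contraNneq phix => ->; rewrite mxE.
have Dd i : forall x, is_derive x (delta_mx 0 i) (fun x => phi x 0 i) (D i i x).
  by have [_ /(_ i)[]] := phiD i.
have cD i : continuous (D i i) by have [_ /(_ i)[]] := phiD i.
rewrite integral_sum//= => [|i].
  by apply: big1 => i _; exact: integral_partial_eq0 (Dd i) (cD i) (phiiM i).
exact: integrable_cube_support (cD i) (partial_cube (Dd i) (phiiM i)).
Qed.

End fields.

(** * Test fields *)

Section test_fields.
Context {K : realType} {n : nat}.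
Implicit Types (x y : 'rV[K]_n) (phi : 'rV[K]_n -> 'rV[K]_n).

Lemma coord_le_norm x (j : 'I_n) : `|x 0 j| <= `|x|.
Proof.
rewrite [leRHS]/Num.Def.normr/= mx_normrE.
exact: (le_bigmax _ (fun i : 'I_1 * 'I_n => `|x i.1 i.2|) (0, j)).
Qed.

Lemma compact_closure_cube (A : set 'rV[K]_n) M :
  A `<=` cube M -> compact (closure A).
Proof.
move=> AM; apply: (@subclosed_compact _ _ (cube M)).
- exact: closed_closure.
- exact: compact_cube.
- have /closure_id -> : closed (@cube K n M).
    by apply: compact_closed; [exact: norm_hausdorff|exact: compact_cube].
  exact: closure_subset.
Qed.

Lemma compact_closure_sub_cube (A : set 'rV[K]_n) :
  compact (closure A) -> exists M, A `<=` cube M.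
Proof.
move=> /compact_bounded /pinfty_ex_gt0[M M0 AM]; exists M => x Ax j.
by apply: le_trans (coord_le_norm x j) _; apply: AM; exact: subset_closure.
Qed.

Lemma lipschitz1 (f f' : K -> K) C : (forall t : K, is_derive t 1 f (f' t)) ->
  (forall t, `|f' t| <= C) -> forall s t, `|f t - f s| <= C * `|t - s|.
Proof.
move=> fd fC.
have h s t : s <= t -> `|f t - f s| <= C * `|t - s|.
  move=> st; have [c _ ->] : exists2 c, c \in `[s, t] & f t - f s = f' c * (t - s).
    apply: MVT_segment => //.
    by apply: continuous_subspaceT; exact: is_derive_continuous fd.
  by rewrite normrM ler_wpM2r.
move=> s t; have [/h//|/ltW/h] := leP s t.
by rewrite distrC (distrC s).
Qed.

Lemma lipschitz_partial (u : 'rV[K]_n -> K) Du C :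
  (forall i x, is_derive x (delta_mx 0 i) u (Du i x)) ->
  (forall i x, `|Du i x| <= C) ->
  forall x y, `|u y - u x| <= n%:R * (C * `|y - x|).
Proof.
move=> uD DC x y.
(* [z k] has the first [k] coordinates of [y] and the others of [x]; consecutive points differ along
   one axis, where the mean value theorem applies. *)
pose z k : 'rV[K]_n := \row_j (if (j < k)%N then y 0 j else x 0 j).
have step k : (k <= n)%N -> `|u (z k) - u x| <= k%:R * (C * `|y - x|).
  elim: k => [|k IHk] kn.
    by rewrite (_ : z 0%N = x) ?subrr ?normr0 ?mul0r//; apply/rowP => j; rewrite mxE.
  pose i := Ordinal kn.
  have -> : u (z k.+1) - u x = (u (z k.+1) - u (z k)) + (u (z k) - u x) by ring.
  apply: le_trans (ler_normD _ _) _.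
  rewrite -natr1 addrC mulrDl mul1r lerD ?IHk 1?ltnW//.
  have zk : z k.+1 = (y 0 i - x 0 i) *: delta_mx 0 i + z k.
    apply/rowP => j; rewrite !mxE eqxx/= ltnS leq_eqVlt -val_eqE/=.
    case: eqVneq => [jk|jk] /=; last by rewrite mulr0 add0r.
    rewrite (_ : j = i); last exact/val_inj.
    by rewrite ltnn mulr1 subrK.
  have zk0 : z k = 0 *: delta_mx 0 i + z k by rewrite scale0r add0r.
  rewrite zk [in X in _ - u X]zk0.
  have := @lipschitz1 (fun h => u (h *: delta_mx 0 i + z k))
    (fun h => Du i (h *: delta_mx 0 i + z k)) C.
  move=> /(_ (fun t => is_derive_line_at (uD i _)) (fun t => DC i _) 0) h.
  apply: le_trans (h _) _; rewrite subr0 ler_wpM2l//.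
    exact: le_trans (DC i x).
  by have := coord_le_norm (y - x) i; rewrite !mxE.
have zn : z n = y by apply/rowP => j; rewrite mxE ltn_ord.
by have := step n (leqnn n); rewrite zn.
Qed.

(** [C1_field] asserts continuity of the partial derivatives, not of the field. Compact support
    bounds these derivatives globally, so the function is Lipschitz. *)
Lemma continuous_partial (u : 'rV[K]_n -> K) Du M :
  (forall i x, is_derive x (delta_mx 0 i) u (Du i x)) ->
  (forall i, continuous (Du i)) -> (forall x, u x != 0 -> cube M x) ->
  continuous u.
Proof.
move=> uD cD uM.
have [C C0 DC] : exists2 C, 0 <= C & forall i x, `|Du i x| <= C.
  have /boolp.choice[C DC] : forall i, exists C, forall x, `|Du i x| <= C.
    move=> i; have [C C0 DC] := bounded_on_cube M (cD i); exists C => x.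
    have [->|/(partial_cube (uD i) uM)] := eqVneq (Du i x) 0; last exact: DC.
    by rewrite normr0.
  exists (\sum_i `|C i|) => [|i x]; first exact: sumr_ge0.
  apply: le_trans (DC i x) (le_trans (ler_norm _) _).
  by rewrite (bigD1 i)//= lerDl sumr_ge0.
have lip := lipschitz_partial uD DC.
have nC0 : 0 < n%:R * C + 1 by rewrite ltr_wpDl// mulr_ge0.
move=> x; have F := nbhs_filter x.
apply/(@cvgrPdist_le _ _ _ _ F) => e e0.
have /(@cvgrPdist_le _ _ _ _ F)/(_ (e / (n%:R * C + 1))) := @cvg_id _ (nbhs x).
rewrite divr_gt0// => /(_ isT); apply: filterS => y xy.
rewrite distrC; apply: le_trans (lip x y) _.
rewrite mulrA (@le_trans _ _ ((n%:R * C + 1) * `|y - x|))//.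
  by rewrite ler_wpM2r// lerDl.
by rewrite -ler_pdivlMl// distrC mulrC.
Qed.

Lemma test_field_C1_vector phi : test_field phi ->
  C1_vector phi (partial phi) /\ exists M, forall x, phi x != 0 -> cube M x.
Proof.
case=> C /compact_closure_sub_cube[M phiM] _; split; last by exists M.
have D i j x : is_derive x (delta_mx 0 i) (fun x => phi x 0 j) (partial phi i j x).
  exact/derivableP/(C i j).1.
move=> j; split=> [|i]; last by split=> [x|]; [exact: D|exact: (C i j).2].
apply: (@continuous_partial _ (fun i => partial phi i j) M) => [i|x].
- exact: (C i j).2.
- by move=> phix; apply: phiM => /=; apply: contraNneq phix => ->; rewrite mxE.
Qed.

Lemma perimeter_ge phi D M (E : set 'rV[K]_n) : C1_vector phi D ->
  (forall x, phi x != 0 -> cube M x) -> (forall x, enorm (phi x) <= 1) ->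
  (\int[lebesgue_rV K n]_(x in E) (divergence phi x)%:E <= perimeter E)%E.
Proof.
move=> phiD phiM phi1; apply: ereal_sup_ubound; exists phi => //; split=> //.
- exact: C1_vectorP phiD.
- exact: (compact_closure_cube (M := M)).
Qed.

End test_fields.

(** * The calibrating field *)

Section calibration.
Context {K : realType}.

(** [G] is controlled on the positive axis only, as [radial_coef] is singular at 0. Because [alpha]
    is positive, [chi] makes the product vanish in a neighbourhood of every [t <= 0]. *)
Lemma C1_real_cutoff (chi chi' G G' : K -> K) (alpha : K) : 0 < alpha ->
  C1_real chi chi' ->
  (forall t : K, t <= alpha -> chi t = 0 /\ chi' t = 0) ->
  (forall t : K, 0 < t -> is_derive t 1 G (G' t)) ->
  (forall t : K, 0 < t -> {for t, continuous G'}) ->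
  C1_real (fun t => chi t * G t) (fun t => chi' t * G t + chi t * G' t).
Proof.
move=> alpha0 chiC chi0 Gd cG'; have cchi := C1_real_continuous chiC.
have [chid cchi'] := chiC.
have near0 (t : K) (g : K -> K) : t < alpha ->
    (forall s, s <= alpha -> g s = 0) -> {near t, (fun=> 0) =1 g}.
  by move=> ta g0; apply: filterS (lt_nbhsl ta) => s /ltW /g0.
have h0 t : t <= alpha -> chi t * G t = 0 by move=> /chi0[-> _]; rewrite mul0r.
have h'0 t : t <= alpha -> chi' t * G t + chi t * G' t = 0.
  by move=> /chi0[-> ->]; rewrite !mul0r addr0.
split=> t; have [t0|ta] := ltP 0 t.
- exact: (is_derive_mul (chid t) (Gd _ t0)).
- have {}ta : t < alpha by exact: le_lt_trans ta _.
  rewrite h'0 ?ltW//; apply: (@near_eq_is_derive K K K (fun=> 0)).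
  exact: near0.
- have cG : {for t, continuous G}.
    by apply/differentiable_continuous/derivable1_diffP; have [] := Gd _ t0.
  exact: (cvgD (cvgM (cchi' t) cG) (cvgM (cchi t) (cG' _ t0))).
- have {}ta : t < alpha by exact: le_lt_trans ta _.
  rewrite /continuous_at h'0 ?ltW//.
  apply: cvg_near_cst; apply: filterS (lt_nbhsl ta) => s /ltW.
  exact: h'0.
Qed.

Lemma smoothstep_affine_C1 (k b : K) :
  C1_real (fun q => smoothstep (k * q + b)) (fun q => smoothstep' (k * q + b) * k).
Proof. exact: C1_real_comp C1_smoothstep (C1_real_affine k b). Qed.

Variables (n : nat) (r R : K).
Hypotheses (n2 : (2 <= n)%N) (r0 : 0 < r) (rR : r < R).

Let R0 : 0 < R. Proof. exact: lt_trans rR. Qed.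

Definition slope : K := (R ^+ (n - 1) + r ^+ (n - 1)) / (R ^+ n - r ^+ n).
Definition pole : K := R ^+ (n - 1) - slope * R ^+ n.

Definition profile (t : K) : K := slope * t + pole / t ^+ (n - 1).

Let rnRn : 0 < R ^+ n - r ^+ n.
Proof. by rewrite subr_gt0 ltrXn2r ?ltW// -lt0n (leq_trans _ n2). Qed.

Lemma slope_gt0 : 0 < slope.
Proof. by rewrite divr_gt0// addr_gt0// exprn_gt0. Qed.

(** [pole] is defined by the condition at [R]; this is the value imposed by the condition at [r],
    and [slope] is what makes the two agree. *)
Lemma poleE : pole = - r ^+ (n - 1) - slope * r ^+ n.
Proof. by rewrite /pole /slope; field; rewrite gt_eqF. Qed.

(** This sign makes the second term of [profile] nondecreasing, so that [profile] is strictly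
    increasing and stays strictly between -1 and 1 inside the shell. *)
Lemma pole_lt0 : pole < 0.
Proof.
rewrite poleE -opprD oppr_lt0 addr_gt0 ?exprn_gt0// mulr_gt0 ?slope_gt0//.
exact: exprn_gt0.
Qed.

Let exprn1 t : t ^+ n = t * t ^+ (n - 1) :> K.
Proof. by rewrite -exprS subn1 prednK// (leq_trans _ n2). Qed.

Lemma profile_R : profile R = 1.
Proof.
rewrite /profile /pole mulrBl divff ?gt_eqF ?exprn_gt0// exprn1.
by rewrite mulrA mulfK ?gt_eqF ?exprn_gt0//; ring.
Qed.

Lemma profile_r : profile r = - 1.
Proof.
rewrite /profile poleE mulrBl mulNr divff ?gt_eqF ?exprn_gt0// exprn1.
by rewrite mulrA mulfK ?gt_eqF ?exprn_gt0//; ring.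
Qed.

Lemma profile_lt s t : 0 < s -> s < t -> profile s < profile t.
Proof.
move=> s0 st; have t0 := lt_trans s0 st; rewrite /profile ltr_leD//.
  by rewrite ltr_pM2l ?slope_gt0.
apply: ler_wnM2l; first exact: ltW pole_lt0.
by rewrite lef_pV2 ?posrE ?exprn_gt0// lerXn2r ?nnegrE// ltW.
Qed.

Lemma profile_le s t : 0 < s -> s <= t -> profile s <= profile t.
Proof. by move=> s0; rewrite le_eqVlt => /predU1P[->//|/(profile_lt s0)/ltW]. Qed.

Lemma continuous_profile t : 0 < t -> {for t, continuous profile}.
Proof.
move=> t0; apply: cvgD; first by apply: cvgM; [exact: cvg_cst|exact: cvg_id].
apply: cvgM; first exact: cvg_cst.
by apply: cvgV; [rewrite expf_neq0 ?gt_eqF|exact: exprn_continuous].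
Qed.

(** The factor g(|x|) / |x| as a function of q = |x|^2; normalising x raises the exponent from
    [n - 1] to [n]. *)
Definition radial_coef (q : K) : K := slope + pole * (Num.sqrt q ^+ n)^-1.
Definition radial_coef' (q : K) : K :=
  - pole * n%:R * (2 * Num.sqrt q ^+ n.+2)^-1.

Lemma radial_coefE q : 0 < q ->
  radial_coef q * Num.sqrt q = profile (Num.sqrt q).
Proof.
move=> q0; have s0 : Num.sqrt q != 0 by rewrite gt_eqF// sqrtr_gt0.
rewrite /radial_coef /profile exprn1 mulrDl; congr (_ + _).
by rewrite invfM mulrA mulrAC mulrVK ?unitfE// [in LHS]mulrAC mulfVK.
Qed.

(** The linear term [slope *: x] carries the whole divergence; x / |x|^n, up to a constant the
    gradient of the fundamental solution of the Laplacian, is divergence free. *)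
Lemma radial_coef_divergence q : 0 < q ->
  2 * q * radial_coef' q + n%:R * radial_coef q = n%:R * slope.
Proof.
move=> q0; have s0 : Num.sqrt q != 0 by rewrite gt_eqF// sqrtr_gt0.
rewrite -{1}(sqr_sqrtr (ltW q0)) /radial_coef' /radial_coef !exprS.
by field; rewrite s0 expf_neq0.
Qed.

Lemma is_derive_radial_coef (q : K) : 0 < q ->
  is_derive q 1 radial_coef (radial_coef' q).
Proof.
move=> q0; have s0 : 0 < Num.sqrt q by rewrite sqrtr_gt0.
have sn0 : Num.sqrt q ^+ n != 0 by rewrite expf_neq0 ?gt_eqF.
have dX (t : K) : is_derive t 1 (fun s => s ^+ n) (n%:R * t ^+ n.-1).
  have := is_deriveX n (is_derive_id t (1 : K)).
  by rewrite exprfctE => /is_derive_eq; apply; rewrite [_ *: _]mulr1.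
have dV := @is_deriveV _ (fun s => s ^+ n) _ _ _ sn0 (dX (Num.sqrt q)).
have := is_derive_comp dV (is_derive1_sqrt q0).
move=> /(is_derive_scale pole)/(is_derive_add (is_derive_const slope q 1)).
move/is_derive_eq; apply; rewrite add0r /radial_coef' /=.
rewrite [_ *: _]mulrC; move: s0 n2; case: n => // m; rewrite /= !exprS => s0 _.
by field; rewrite ?expf_neq0 ?gt_eqF.
Qed.

Lemma continuous_radial_coef' q : 0 < q -> {for q, continuous radial_coef'}.
Proof.
move=> q0; apply: cvgM; first exact: cvg_cst.
apply: cvgV; first by rewrite mulf_neq0// expf_neq0 ?gt_eqF ?sqrtr_gt0.
apply: cvgM; first exact: cvg_cst.
exact: (continuous_comp (@sqrt_continuous K q) (@exprn_continuous K n.+2 _)).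
Qed.

Lemma profile_near (eps : K) : 0 < eps ->
  exists r' R', [/\ 0 < r' < r, R < R', - (1 + eps) < profile r' &
    profile R' < 1 + eps].
Proof.
move=> eps0.
have /nbhs_ballP[e1 /= e10 P1] : \forall t \near r, - (1 + eps) < profile t.
  have pr : - (1 + eps) < profile r by rewrite profile_r ltrN2 ltrDl.
  exact: (continuous_profile r0 (lt_nbhsr pr)).
have /nbhs_ballP[e2 /= e20 P2] : \forall t \near R, profile t < 1 + eps.
  have pR : profile R < 1 + eps by rewrite profile_R ltrDl.
  exact: (continuous_profile R0 (lt_nbhsl pR)).
have {}e10 : (0 : K) < e1 by []; have {}e20 : (0 : K) < e2 by [].
have r0' : 0 < r by exact: r0.
(* The maximum with [r / 2] keeps the inner radius positive however large [e1] is. *)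
exists (Num.max (r - e1 / 2) (r / 2)), (R + e2 / 2); split.
- rewrite lt_max gt_max divr_gt0// orbT/=; clear P1 P2.
  by apply/andP; split; lra.
- by clear P1 P2; lra.
- apply: P1; clear P2; rewrite -ball_normE /ball_/= ger0_norm.
    by rewrite ltrBlDr -ltrBlDl lt_max; apply/orP; left; lra.
  by rewrite subr_ge0 ge_max; apply/andP; split; lra.
- apply: P2; clear P1; rewrite -ball_normE /ball_/= ltr_norml.
  by apply/andP; split; lra.
Qed.

(** [q] stands for the squared norm, so the third clause bounds the length of the field f(|x|^2) x
    in the whole space: division by [1 + eps] makes it admissible. *)
Definition calibration_spec (eps M : K) (f f' : K -> K) : Prop :=
  [/\ C1_real f f',
    forall q, r ^+ 2 <= q <= R ^+ 2 -> f q = radial_coef q /\ f' q = radial_coef' q,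
    forall q, 0 <= q -> `|f q| * Num.sqrt q <= 1 + eps &
    forall q, M < q -> f q = 0].

(** The cutoff acts in two collars outside the shell, between [r'] and [r] and between [R] and [R'],
    chosen so thin that the profile exceeds 1 in absolute value by at most [eps] there. *)
Lemma calibration (eps : K) : 0 < eps ->
  exists M f f', calibration_spec eps M f f'.
Proof.
move=> eps0; have [r' [R' [/andP[r'0 r'r] RR' pr' pR']]] := profile_near eps0.
have R'0 : 0 < R' by exact: lt_trans RR'.
(* Inverse widths of the two collars in the variable q, so that [s1] and [s2] run from 0 to 1 across
   them. *)
pose k := (r ^+ 2 - r' ^+ 2)^-1; pose l := (R' ^+ 2 - R ^+ 2)^-1.
have k0 : 0 < k by rewrite invr_gt0 subr_gt0 ltrXn2r// ltW.
have l0 : 0 < l by rewrite invr_gt0 subr_gt0 ltrXn2r// ltW.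
pose s1 (q : K) := k * q + (- k * r' ^+ 2).
pose s2 (q : K) := (- l) * q + l * R' ^+ 2.
have s1E q : s1 q = k * (q - r' ^+ 2) by rewrite /s1; ring.
have s2E q : s2 q = l * (R' ^+ 2 - q) by rewrite /s2; ring.
pose chi q : K := smoothstep (s1 q) * smoothstep (s2 q).
pose chi' q : K := smoothstep' (s1 q) * k * smoothstep (s2 q)
  + smoothstep (s1 q) * (smoothstep' (s2 q) * - l).
have chiC : C1_real chi chi'.
  exact: (C1_real_mul (smoothstep_affine_C1 k _) (smoothstep_affine_C1 (- l) _)).
have s1_le0 q : q <= r' ^+ 2 -> s1 q <= 0.
  by move=> q1; rewrite s1E pmulr_rle0// subr_le0.
have s1_ge1 q : r ^+ 2 <= q -> 1 <= s1 q.
  by move=> q1; rewrite s1E mulrC -ler_pdivrMr// invrK mul1r lerB.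
have s2_le0 q : R' ^+ 2 <= q -> s2 q <= 0.
  by move=> q1; rewrite s2E pmulr_rle0// subr_le0.
have s2_ge1 q : q <= R ^+ 2 -> 1 <= s2 q.
  by move=> q1; rewrite s2E mulrC -ler_pdivrMr// invrK mul1r lerB.
exists (R' ^+ 2), (fun q => chi q * radial_coef q),
  (fun q => chi' q * radial_coef q + chi q * radial_coef' q); split.
- have chi0 q : q <= r' ^+ 2 -> chi q = 0 /\ chi' q = 0.
    move=> /s1_le0 q1; rewrite /chi /chi' smoothstep_eq0// smoothstep'_eq0 ?q1//.
    by rewrite !mul0r addr0.
  exact: (C1_real_cutoff (exprn_gt0 2 r'0) chiC chi0 is_derive_radial_coef
    continuous_radial_coef').
- move=> q /andP[/s1_ge1 q1 /s2_ge1 q2]; rewrite /chi /chi'.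
  rewrite !smoothstep_eq1// !smoothstep'_eq0 ?q1 ?q2 ?orbT//.
  by rewrite !mul0r mulr0 add0r !mulr1 !mul1r mul0r add0r.
- move=> q q0; rewrite normrM.
  have [/s1_le0 q1|q1] := leP q (r' ^+ 2).
    by rewrite /chi smoothstep_eq0// mul0r normr0 !mul0r addr_ge0// ltW.
  have [/s2_le0 q2|q2] := leP (R' ^+ 2) q.
    by rewrite /chi (smoothstep_eq0 q2) mulr0 normr0 !mul0r addr_ge0// ltW.
  have q0' : 0 < q by apply: lt_trans q1; exact: exprn_gt0.
  have chi1 : `|chi q| <= 1.
    rewrite normrM; have /andP[a0 a1] := smoothstep_itv (s1 q).
    have /andP[b0 b1] := smoothstep_itv (s2 q).
    by rewrite !ger0_norm// mulr_ile1.
  rewrite -mulrA; apply: (@le_trans _ _ (1 * `|profile (Num.sqrt q)|)).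
    apply: ler_pM chi1 _ => //.
    by rewrite -radial_coefE// normrM (ger0_norm (sqrtr_ge0 q)).
  have rs : r' <= Num.sqrt q.
    by rewrite -(ger0_norm (ltW r'0)) -sqrtr_sqr ler_wsqrtr// ltW.
  have sR : Num.sqrt q <= R'.
    by rewrite -[leRHS](ger0_norm (ltW R'0)) -sqrtr_sqr ler_wsqrtr// ltW.
  rewrite mul1r ler_norml; apply/andP; split.
    by apply: le_trans (ltW pr') _; exact: profile_le.
  by apply: le_trans (ltW pR'); apply: profile_le => //; exact: lt_le_trans rs.
- by move=> q /ltW/s2_le0 q2; rewrite /chi (smoothstep_eq0 q2) mulr0 mul0r.
Qed.

End calibration.

(** * Lower bound and rigidity of the perimeter *)

Section shell.
Context {K : realType} {n : nat}.
Implicit Types (x y : 'rV[K]_n).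

Lemma enormE x : enorm x = Num.sqrt (sqn x). Proof. by []. Qed.

Lemma enorm_ge0 x : 0 <= enorm x. Proof. exact: sqrtr_ge0. Qed.

Lemma sqr_coord_le x (j : 'I_n) : x 0 j ^+ 2 <= sqn x.
Proof. by rewrite /sqn (bigD1 j)//= lerDl sumr_ge0// => i _; exact: sqr_ge0. Qed.

Lemma coord_le_enorm x (j : 'I_n) : `|x 0 j| <= enorm x.
Proof. by rewrite -sqrtr_sqr ler_wsqrtr// sqr_coord_le. Qed.

(** From |t| <= 1 + t^2: a bound on the squared norm places the support in a cube. *)
Lemma coord_le_sqn x (j : 'I_n) : `|x 0 j| <= 1 + sqn x.
Proof.
have := sqr_coord_le x j; rewrite -[x 0 j ^+ 2]real_normK ?num_real// => xj.
apply: le_trans (lerD (lexx 1) xj); have [x1|/ltW x1] := leP `|x 0 j| 1.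
  by rewrite (le_trans x1)// lerDl sqr_ge0.
by rewrite (@le_trans _ _ (`|x 0 j| ^+ 2)) ?ler_eXnr// lerDr.
Qed.

Lemma sqnZ a x : sqn (a *: x) = a ^+ 2 * sqn x.
Proof. by rewrite /sqn mulr_sumr; apply: eq_bigr => i _; rewrite mxE exprMn. Qed.

Lemma enormZ a x : enorm (a *: x) = `|a| * enorm x.
Proof. by rewrite !enormE sqnZ sqrtrM ?sqr_ge0// sqrtr_sqr. Qed.

(** The triangle inequality for a perturbation along one axis, the form used for rigidity; the cross
    term is controlled by [coord_le_enorm]. *)
Lemma enorm_add_delta x a (i : 'I_n) : enorm (x + a *: delta_mx 0 i) <= enorm x + `|a|.
Proof.
have E : sqn (x + a *: delta_mx 0 i) = sqn x + 2 * (a * x 0 i) + a ^+ 2.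
  rewrite /sqn (bigD1 i)//= [X in _ = X + _ + _](bigD1 i)//= !mxE !eqxx/=.
  rewrite (eq_bigr (fun j => x 0 j ^+ 2)); first by ring.
  by move=> j ji; rewrite !mxE (negbTE ji) andbF mulr0 addr0.
rewrite -[leRHS]ger0_norm ?addr_ge0 ?enorm_ge0// -sqrtr_sqr enormE ler_wsqrtr//.
rewrite E sqrrD sqr_enorm real_normK ?num_real// lerD2r lerD2l.
rewrite mulr_natl lerMn2r/= (le_trans (ler_norm _))// normrM mulrC ler_wpM2r//.
exact: coord_le_enorm.
Qed.

Lemma continuous_sqn : continuous (@sqn K n).
Proof. by have [] := @C1_scalar_sqn K n. Qed.

Lemma continuous_enorm : continuous (fun x => enorm x).
Proof.
by move=> x; exact: (continuous_comp (@continuous_sqn x) (@sqrt_continuous K _)).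
Qed.

Lemma open_shell r R : open (spherical_shell (R := K) n r R).
Proof.
have -> : spherical_shell n r R = (fun x => enorm x) @^-1` `]r, R[%classic.
  by apply/seteqP; split=> x /=; rewrite in_itv.
by have /continuousP := continuous_enorm; apply; exact: interval_open.
Qed.

Lemma measurable_shell r R : measurable (spherical_shell (R := K) n r R).
Proof. by apply: open_measurable_rV; exact: open_shell. Qed.

Lemma shell_cube r R : spherical_shell (R := K) n r R `<=` cube R.
Proof. by move=> x /andP[_ /ltW xR] j; exact: le_trans (coord_le_enorm x j) xR. Qed.

Lemma shell_sqn r R x : 0 <= r -> 0 <= R ->
  spherical_shell n r R x = (r ^+ 2 < sqn x < R ^+ 2) :> Prop.
Proof.
by move=> r0 R0; rewrite -sqr_enorm !ltr_pXn2r// nnegrE enorm_ge0.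
Qed.

Lemma cube_le M N : M <= N -> cube M `<=` @cube K n N.
Proof. by move=> MN x xM j; exact: le_trans (xM j) MN. Qed.

Lemma integral_affine (S : set 'rV[K]_n) (g : 'rV[K]_n -> K) M (c h m I : K) :
  measurable S -> S `<=` cube M -> continuous g ->
  lebesgue_rV K n S = m%:E ->
  (\int[lebesgue_rV K n]_(x in S) (g x)%:E = I%:E)%E ->
  (\int[lebesgue_rV K n]_(x in S) (c * (h + g x))%:E = (c * (h * m + I))%:E)%E.
Proof.
move=> mS SM cg Sm SI.
have ig := integrable_cube mS cg SM.
have ih : (lebesgue_rV K n).-integrable S (EFin \o (fun=> h)).
  by apply: (integrable_cube (M := M)) => //; exact: cst_continuous.
under eq_integral do rewrite EFinM EFinD.
rewrite integralZl//; last exact: integrableD.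
rewrite integralD// SI integral_cst// !(EFinM, EFinD).
by congr (_ * (_ * _ + _))%E.
Qed.

Variables (r R : K).
Hypotheses (n2 : (2 <= n)%N) (r0 : 0 < r) (rR : r < R).

Let R0 : 0 < R. Proof. exact: lt_trans rR. Qed.

Local Notation shell := (spherical_shell (R := K) n r R).
Local Notation h := (n%:R * slope n r R).

Lemma shell_bounds x : shell x ->
  [/\ 0 < sqn x, r ^+ 2 <= sqn x <= R ^+ 2 & r ^+ 2 < sqn x < R ^+ 2].
Proof.
rewrite (shell_sqn _ (ltW r0) (ltW R0)) => /andP[rx xR].
split; [|by rewrite (ltW rx) (ltW xR)|by rewrite rx].
by apply: lt_trans rx; exact: exprn_gt0.
Qed.

(** One inequality serves twice: [psi = 0] gives the lower bound on the perimeter, a small bump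
    along an axis gives rigidity. *)
Lemma perimeter_ge_calibrated eps M f f' psi D N (S : set 'rV[K]_n) m I :
  0 < eps -> calibration_spec n r R eps M f f' ->
  C1_vector psi D -> (forall x, psi x != 0 -> cube N x) ->
  (forall x, enorm (f (sqn x) *: x + psi x) <= 1 + eps) ->
  measurable S -> S `<=` shell -> lebesgue_rV K n S = m%:E ->
  (\int[lebesgue_rV K n]_(x in S) (divergence psi x)%:E = I%:E)%E ->
  (((1 + eps)^-1 * (h * m + I))%:E <= perimeter S)%E.
Proof.
move=> eps0 [fC f_eq _ f0] psiD psiN le1 mS Sshell Sm SI.
have e0 : 0 < 1 + eps by rewrite addr_gt0.
pose phi x := f (sqn x) *: x + psi x.
have fD := C1_vector_scale (C1_scalar_radial fC) (@C1_vector_id K n).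
have phiD : C1_vector phi _ := C1_vector_add fD psiD.
have PhiD := C1_vector_scale (C1_scalar_const (1 + eps)^-1) phiD.
have cdiv : continuous (divergence psi) by exact/continuous_divergence/(C1_vectorP psiD).
(* [f] vanishes at squared norms above [M], which confines its field to the cube of half-side
   [1 + M] by [coord_le_sqn]; [N] takes care of [psi]. *)
have := @perimeter_ge K n _ _ (Num.max (1 + M) N) S PhiD.
rewrite [X in (X <= _)%E](_ : _ = ((1 + eps)^-1 * (h * m + I))%:E).
  apply=> x.
    move=> Phi0; have {Phi0} : phi x != 0 by apply: contraNneq Phi0 => ->; rewrite scaler0.
    have [psi0|/psiN xN _] := eqVneq (psi x) 0; last first.
      by apply: cube_le xN; rewrite le_max lexx orbT.
    rewrite /phi psi0 addr0 => fx j; apply: le_trans (coord_le_sqn x j) _.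
    rewrite le_max lerD2l; apply/orP; left; rewrite leNgt; apply/negP => /f0 fx0.
    by move: fx; rewrite fx0 scale0r eqxx.
  rewrite enormZ ger0_norm ?invr_ge0 ?(ltW e0)// ler_pdivrMl// mulr1.
  exact: le1.
have SR : S `<=` cube R by move=> x /Sshell; exact: shell_cube.
rewrite -(integral_affine (1 + eps)^-1 h mS SR cdiv Sm SI).
apply: eq_integral => x /set_mem /Sshell /shell_bounds[x0 /f_eq[fx f'x] _].
rewrite (divergence_scale x (C1_scalar_const (1 + eps)^-1)); last by eexists; exact: phiD.
rewrite big1 ?add0r => [|i _]; last by rewrite mul0r.
rewrite divergence_add; [|by eexists; exact: fD|by eexists; exact: psiD].
by rewrite (divergence_radial x fC) fx f'x radial_coef_divergence.
Qed.

(** The passage to the limit [eps -> 0] shared by the lower bound, the upper bound and rigidity;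
    [e / (|p| + 1)] is small enough that its product with [p] stays below [e]. *)
Lemma le_of_shrinked (x p : K) :
  (forall eps, 0 < eps -> (1 + eps)^-1 * x <= p) -> x <= p.
Proof.
move=> xp; apply/ler_addgt0Pr => e e0.
have p0 : 0 < `|p| + 1 by rewrite ltr_wpDl.
have ep : 0 < e / (`|p| + 1) by rewrite divr_gt0.
have := xp _ ep; rewrite ler_pdivrMl ?addr_gt0// => /le_trans; apply.
rewrite mulrDl mul1r lerD2l mulrAC ler_pdivrMr// ler_pM2l//.
by rewrite (le_trans (ler_norm p))// lerDl.
Qed.

Lemma perimeter_ge_measure (S : set 'rV[K]_n) m :
  measurable S -> S `<=` shell -> lebesgue_rV K n S = m%:E ->
  ((h * m)%:E <= perimeter S)%E.
Proof.
move=> mS Sshell Sm.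
have psiD : C1_vector (fun=> 0 : 'rV[K]_n) (fun _ _ _ => 0).
  by move=> j; have := @C1_scalar_const K n 0; congr C1_scalar; apply/funext => x; rewrite mxE.
have S0 : (\int[lebesgue_rV K n]_(x in S) (divergence (fun=> 0 : 'rV[K]_n) x)%:E = 0%:E)%E.
  by apply: integral0_eq => x _; rewrite (divergenceE x psiD) big1.
have key eps : 0 < eps -> (((1 + eps)^-1 * (h * m))%:E <= perimeter S)%E.
  move=> eps0; have [M [f [f' cal]]] := calibration n2 r0 rR eps0.
  have [_ _ f1 _] := cal.
  rewrite -[X in (_ * X)%:E]addr0.
  apply: (perimeter_ge_calibrated eps0 cal psiD (N := 0) _ _ mS Sshell Sm S0).
    by move=> x; rewrite eqxx.
  by move=> x; rewrite addr0 enormZ; exact: f1 (sqn_ge0 x).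
move: key; case: (perimeter S) => [p| |] key; last 2 first.
- by rewrite leey.
- by have := key 1 ltr01; rewrite leeNy_eq.
- by rewrite lee_fin; apply: le_of_shrinked => eps /key; rewrite lee_fin.
Qed.

(** When the calibration bound is attained, a perturbation of the calibrating field cannot increase
    the flux, so [I (Dv i) <= 0] for every admissible [v]. Applying this to [u] and to [-u] gives
    equality. *)
Lemma perimeter_eq_flux0 (S : set 'rV[K]_n) m u Du a b i :
  measurable S -> S `<=` shell -> lebesgue_rV K n S = m%:E ->
  perimeter S = (h * m)%:E ->
  C1_scalar u Du -> (forall x, `|u x| <= 1) ->
  r ^+ 2 < a -> b < R ^+ 2 -> (forall x, u x != 0 -> a <= sqn x <= b) ->
  (\int[lebesgue_rV K n]_(x in S) (Du i x)%:E = 0)%E.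
Proof.
move=> mS Sshell Sm PS uD u1 ra bR uab.
have SR : S `<=` cube R by move=> x /Sshell; exact: shell_cube.
(* If [b < a], the support condition forces [u = 0]; otherwise [a <= b] makes [b] positive. *)
have [ab|ba] := leP a b; last first.
  have u0 x : u x = 0.
    apply/eqP/negPn/negP => /uab /andP[ax xb].
    by have := lt_le_trans ba (le_trans ax xb); rewrite ltxx.
  apply: integral0_eq => x _; congr EFin.
  have [_ /(_ i)[/(_ x)[_ <-] _]] := uD.
  by rewrite (_ : u = fun=> 0) ?derive_cst//; exact/funext.
pose I v : K := fine (\int[lebesgue_rV K n]_(x in S) (v x)%:E)%E.
have IE v : continuous v -> (\int[lebesgue_rV K n]_(x in S) (v x)%:E = (I v)%:E)%E.
  move=> cv; rewrite /I fineK//; apply: integrable_fin_num => //.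
  exact: integrable_cube SR.
have key v Dv : C1_scalar v Dv -> (forall x, `|v x| <= 1) ->
    (forall x, v x != 0 -> a <= sqn x <= b) -> I (Dv i) <= 0.
  move=> vD v1 vab; have a0 : 0 < a by apply: lt_trans ra; exact: exprn_gt0.
  have ra' : r < Num.sqrt a.
    by rewrite -(ger0_norm (ltW r0)) -sqrtr_sqr ltr_sqrt.
  have bR' : Num.sqrt b < R.
    by rewrite -(ger0_norm (ltW R0)) -sqrtr_sqr ltr_sqrt ?exprn_gt0.
  have b0 : 0 < Num.sqrt b by rewrite sqrtr_gt0 (lt_le_trans a0).
  (* The gap between |g| and 1 where [a <= sqn x <= b]; g being increasing, it is read off at the
     two extreme radii. *)
  pose delta := Num.min (1 + profile n r R (Num.sqrt a)) (1 - profile n r R (Num.sqrt b)).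
  have delta0 : 0 < delta.
    rewrite lt_min subr_gt0 -(profile_R n2 r0 rR) profile_lt// andbT.
    by rewrite profile_R// addrC -[1]opprK subr_gt0 -(profile_r n2 r0 rR) profile_lt.
  have wD : C1_scalar (fun x => delta * v x) (fun i x => delta * Dv i x).
    exact: C1_scalar_scale.
  have psiD := C1_vector_delta i wD.
  have cDv : continuous (Dv i) by have [_ /(_ i)[]] := vD.
  have SI : (\int[lebesgue_rV K n]_(x in S)
      (divergence (fun x => (delta * v x) *: delta_mx 0 i) x)%:E = (delta * I (Dv i))%:E)%E.
    under eq_integral do rewrite (divergence_delta i _ wD) EFinM.
    by rewrite integralZl// ?(IE _ cDv)//; exact: integrable_cube SR.
  suff : h * m + delta * I (Dv i) <= h * m by rewrite gerDl pmulr_rle0.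
  apply: le_of_shrinked => eps eps0; rewrite -lee_fin -PS.
  have [M [f [f' cal]]] := calibration n2 r0 rR eps0.
  have [_ f_eq f1 _] := cal.
  apply: (perimeter_ge_calibrated eps0 cal psiD (N := 1 + b) _ _ mS Sshell Sm SI).
    move=> x vx0 j; apply: le_trans (coord_le_sqn x j) _; rewrite lerD2l.
    have /vab/andP[] : v x != 0; last by [].
    by apply: contraNneq vx0 => ->; rewrite mulr0 scale0r.
  move=> x; apply: le_trans (enorm_add_delta _ _ _) _; rewrite enormZ.
  have [->|/vab/andP[ax xb]] := eqVneq (v x) 0.
    by rewrite mulr0 normr0 addr0; exact: f1 (sqn_ge0 x).
  have x0 : 0 < sqn x by exact: lt_le_trans ax.
  have /f_eq[-> _] : r ^+ 2 <= sqn x <= R ^+ 2.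
    by rewrite (le_trans (ltW ra) ax) (le_trans xb (ltW bR)).
  have -> : `|radial_coef n r R (sqn x)| * enorm x = `|profile n r R (enorm x)|.
    by rewrite enormE -radial_coefE// normrM (ger0_norm (sqrtr_ge0 _)).
  apply: (@le_trans _ _ (1 - delta + delta)); last by rewrite subrK lerDl ltW.
  apply: lerD; last first.
    by rewrite normrM (ger0_norm (ltW delta0)) ger_pMr.
  have d1 : delta <= 1 + profile n r R (Num.sqrt a) by rewrite ge_min lexx.
  have d2 : delta <= 1 - profile n r R (Num.sqrt b) by rewrite ge_min lexx orbT.
  have p1 : profile n r R (Num.sqrt a) <= profile n r R (enorm x).
    by apply: profile_le => //; [rewrite sqrtr_gt0|exact: ler_wsqrtr].
  have p2 : profile n r R (enorm x) <= profile n r R (Num.sqrt b).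
    by apply: profile_le => //; [rewrite enormE sqrtr_gt0|exact: ler_wsqrtr].
  rewrite ler_norml; clearbody delta; clear -d1 d2 p1 p2.
  by apply/andP; split; lra.
have cDu : continuous (Du i) by have [_ /(_ i)[]] := uD.
rewrite (IE _ cDu); congr EFin; apply/eqP; rewrite eq_le (key u Du)//=.
have := key (fun x => -1 * u x) (fun i x => -1 * Du i x) (C1_scalar_scale _ uD).
rewrite {1}/I; under eq_integral do rewrite EFinM.
rewrite integralZl//; last exact: integrable_cube SR.
rewrite (IE _ cDu) -EFinM/= mulN1r oppr_le0; apply=> x.
  by rewrite mulN1r normrN.
by rewrite mulN1r oppr_eq0; exact: uab.
Qed.

End shell.

(** * Perimeter of the shell *)

Section shell_perimeter.
Context {K : realType} {n : nat}.
Implicit Types (x y : 'rV[K]_n).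

Lemma dot_le_enorm x y : 0 < enorm x -> enorm y <= 1 ->
  `|\sum_i x 0 i * y 0 i| <= enorm x.
Proof.
move=> x0 y1; set rho := enorm x in x0 *.
have rho2 : \sum_i x 0 i ^+ 2 = rho ^+ 2 by rewrite /rho sqr_enorm.
have y2 : \sum_i y 0 i ^+ 2 <= 1.
  by rewrite -/(sqn y) -sqr_enorm exprn_ile1// enorm_ge0.
apply: le_trans (ler_norm_sum _ _ _) _.
(* AM-GM: |x_i y_i| <= (x_i^2 / rho + rho y_i^2) / 2 *)
apply: (@le_trans _ _ (\sum_i (x 0 i ^+ 2 / rho + rho * y 0 i ^+ 2) / 2)).
  apply: ler_sum => i _; rewrite normrM.
  rewrite -(real_normK (num_real (x 0 i))) -(real_normK (num_real (y 0 i))).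
  set a := `|x 0 i|; set b := `|y 0 i|.
  rewrite -subr_ge0 (_ : _ - _ = (a - rho * b) ^+ 2 / (2 * rho)).
    by rewrite divr_ge0 ?sqr_ge0// mulr_ge0// ltW.
  by field; rewrite gt_eqF.
rewrite -mulr_suml big_split/= -mulr_suml -mulr_sumr rho2 expr2 mulfK ?gt_eqF//.
rewrite ler_pdivrMr// mulr_natr mulr2n lerD2l.
by rewrite ger_pMr.
Qed.

Variables (r R : K).
Hypotheses (n2 : (2 <= n)%N) (r0 : 0 < r) (rR : r < R).

Let R0 : 0 < R. Proof. exact: lt_trans rR. Qed.

Local Notation shell := (spherical_shell (R := K) n r R).
Local Notation h := (n%:R * slope n r R).
Local Notation p := (profile n r R).

(** Counterpart of [profile_near] with radii inside the shell, locating the layers in which the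
    cutoff of the upper bound may vary; [R / 2] keeps the outer one positive. *)
Lemma profile_near_in (c : K) : c < 1 ->
  exists r1 R1, [/\ r < r1, 0 < R1 < R, p r1 < - c & c < p R1].
Proof.
move=> c1; have r0' : 0 < r by exact: r0.
have R0' : 0 < R by exact: R0.
have pr : p r < - c by rewrite profile_r// ltrN2.
have pR : c < p R by rewrite profile_R.
have /nbhs_ballP[e1 /= e10 P1] := @continuous_profile K n r R _ r0 _ (lt_nbhsl pr).
have /nbhs_ballP[e2 /= e20 P2] := @continuous_profile K n r R _ R0 _ (lt_nbhsr pR).
have {}e10 : (0 : K) < e1 by []; have {}e20 : (0 : K) < e2 by [].
exists (r + e1 / 2), (Num.max (R - e2 / 2) (R / 2)); split.
- by clear P1 P2; lra.
- rewrite lt_max gt_max divr_gt0// orbT/=; clear P1 P2.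
  by apply/andP; split; lra.
- apply: P1; clear P2; rewrite -ball_normE /ball_/= ltr_norml.
  by apply/andP; split; lra.
- apply: P2; clear P1; rewrite -ball_normE /ball_/= ger0_norm.
    by rewrite ltrBlDr -ltrBlDl lt_max; apply/orP; left; lra.
  by rewrite subr_ge0 ge_max; apply/andP; split; lra.
Qed.

(** In the variable q, the first factor rises over a width 1/k just after [r ^+ 2], the second falls
    over a width 1/k just before [R ^+ 2]. *)
Definition cutoff (k q : K) : K :=
  smoothstep (k * q + - k * r ^+ 2) * smoothstep (- k * q + k * R ^+ 2).

Definition cutoff' (k q : K) : K :=
  smoothstep' (k * q + - k * r ^+ 2) * k * smoothstep (- k * q + k * R ^+ 2) +
  smoothstep (k * q + - k * r ^+ 2) * (smoothstep' (- k * q + k * R ^+ 2) * - k).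

Lemma C1_cutoff k : C1_real (cutoff k) (cutoff' k).
Proof. exact: C1_real_mul (smoothstep_affine_C1 _ _) (smoothstep_affine_C1 _ _). Qed.

Let inner (k q : K) : k * q + - k * r ^+ 2 = k * (q - r ^+ 2).
Proof. by ring. Qed.

Let outer (k q : K) : - k * q + k * R ^+ 2 = k * (R ^+ 2 - q).
Proof. by ring. Qed.

Lemma cutoff_itv k q : 0 <= cutoff k q <= 1.
Proof.
have /andP[a0 a1] := smoothstep_itv (k * q + - k * r ^+ 2).
have /andP[b0 b1] := smoothstep_itv (- k * q + k * R ^+ 2).
by rewrite /cutoff mulr_ge0// mulr_ile1.
Qed.

Lemma cutoff_out k q : 0 < k -> ~~ (r ^+ 2 < q < R ^+ 2) ->
  cutoff k q = 0 /\ cutoff' k q = 0.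
Proof.
move=> k0; rewrite negb_and -!leNgt /cutoff /cutoff' inner outer.
move=> /orP[qr|Rq].
  have t0 : k * (q - r ^+ 2) <= 0 by rewrite pmulr_rle0// subr_le0.
  by rewrite smoothstep_eq0// smoothstep'_eq0 ?t0// !mul0r addr0.
have t0 : k * (R ^+ 2 - q) <= 0 by rewrite pmulr_rle0// subr_le0.
by rewrite (smoothstep_eq0 t0) (@smoothstep'_eq0 _ (k * (R ^+ 2 - q))) ?t0// mul0r !mulr0 addr0.
Qed.

Lemma cutoff_cvg (q : K) : r ^+ 2 < q < R ^+ 2 ->
  \forall k \near \oo, cutoff k%:R q = 1.
Proof.
move=> /andP[rq qR]; near=> k.
have k1 : (q - r ^+ 2)^-1 <= k%:R by near: k; exact: nbhs_infty_ger.
have k2 : (R ^+ 2 - q)^-1 <= k%:R by near: k; exact: nbhs_infty_ger.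
rewrite /cutoff inner outer !smoothstep_eq1 ?mulr1//.
  by rewrite -ler_pdivrMr ?subr_gt0// mul1r.
by rewrite -ler_pdivrMr ?subr_gt0// mul1r.
Unshelve. all: by end_near. Qed.

(* The cutoff only varies where the profile is close to -1 (there it increases)
   or close to 1 (there it decreases). *)
Lemma cutoff'_profile e : 0 < e -> \forall k \near \oo, 0 < k%:R :> K /\
  forall q, r ^+ 2 < q < R ^+ 2 ->
  `|cutoff' k%:R q| <= (1 + e) * (- cutoff' k%:R q * p (Num.sqrt q)).
Proof.
move=> e0; have e1 : 0 < 1 + e by rewrite addr_gt0.
have c1 : (1 + e)^-1 < 1 by rewrite invf_lt1// ltrDl.
have [r1 [R1 [rr1 /andP[R10 R1R] pr1 pR1]]] := profile_near_in c1.
have r10 : 0 < r1 by exact: lt_trans rr1.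
have d1 : 0 < r1 ^+ 2 - r ^+ 2 by rewrite subr_gt0 ltr_pXn2r// nnegrE ltW.
have d2 : 0 < R ^+ 2 - R1 ^+ 2 by rewrite subr_gt0 ltr_pXn2r// nnegrE ltW.
near=> k; have k0 : 0 < k%:R :> K by near: k; exact: nbhs_infty_gtr.
split=> // q /andP[rq qR].
have q0 : 0 < q by apply: lt_trans rq; exact: exprn_gt0.
have s0 : 0 < Num.sqrt q by rewrite sqrtr_gt0.
(* [k] is so large that the inner layer ends before [r1] and the outer one starts after [R1]. *)
have k1 : (r1 ^+ 2 - r ^+ 2)^-1 <= k%:R by near: k; exact: nbhs_infty_ger.
have k2 : (R ^+ 2 - R1 ^+ 2)^-1 <= k%:R by near: k; exact: nbhs_infty_ger.
have {}k1 : k%:R^-1 <= r1 ^+ 2 - r ^+ 2 by rewrite -[leRHS]invrK lef_pV2 ?posrE ?invr_gt0.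
have {}k2 : k%:R^-1 <= R ^+ 2 - R1 ^+ 2 by rewrite -[leRHS]invrK lef_pV2 ?posrE ?invr_gt0.
rewrite /cutoff' inner outer.
set A' := smoothstep' (k%:R * (q - _)); set A := smoothstep (k%:R * (q - _)).
set B' := smoothstep' (k%:R * (_ - q)); set B := smoothstep (k%:R * (_ - q)).
have A'0 : 0 <= A' by exact: smoothstep'_ge0.
have B'0 : 0 <= B' by exact: smoothstep'_ge0.
have /andP[A0 _] : 0 <= A <= 1 by exact: smoothstep_itv.
have /andP[B0 _] : 0 <= B <= 1 by exact: smoothstep_itv.
have hA : A' <= (1 + e) * (A' * - p (Num.sqrt q)).
  have [t1|t1] := leP 1 (k%:R * (q - r ^+ 2)).
    by rewrite /A' smoothstep'_eq0 ?t1 ?orbT// mul0r mulr0.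
  have qr1 : q <= r1 ^+ 2.
    move: t1; rewrite -ltr_pdivlMl// mulr1 => t1.
    by rewrite -(lerD2r (- r ^+ 2)) (le_trans (ltW t1)).
  have sr1 : Num.sqrt q <= r1.
    by rewrite -(ger0_norm (ltW r10)) -sqrtr_sqr ler_wsqrtr.
  have := profile_le n2 r0 rR s0 sr1 => /le_lt_trans/(_ pr1); rewrite ltrNr => ps.
  rewrite mulrCA ler_peMr// mulrC -ler_pdivrMr// mul1r ltW//.
have hB : B' <= (1 + e) * (B' * p (Num.sqrt q)).
  have [t1|t1] := leP 1 (k%:R * (R ^+ 2 - q)).
    by rewrite /B' smoothstep'_eq0 ?t1 ?orbT// mul0r mulr0.
  have qr1 : R1 ^+ 2 <= q.
    move: t1; rewrite -ltr_pdivlMl// mulr1 => t1.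
    by rewrite -lerN2 -(lerD2l (R ^+ 2)) (le_trans (ltW t1)).
  have sr1 : R1 <= Num.sqrt q.
    by rewrite -(ger0_norm (ltW R10)) -sqrtr_sqr ler_wsqrtr.
  have := profile_le n2 r0 rR R10 sr1 => /(lt_le_trans pR1) ps.
  by rewrite mulrCA ler_peMr// mulrC -ler_pdivrMr// mul1r ltW.
clearbody A' A B' B; set k' : K := k%:R in k0 *.
have X0 : 0 <= k' * (A' * B) by rewrite !mulr_ge0// ltW.
have Y0 : 0 <= k' * (A * B') by rewrite !mulr_ge0// ltW.
apply: (@le_trans _ _ (k' * (A' * B) + k' * (A * B'))).
  rewrite (_ : _ + _ * (_ * - k') = k' * (A' * B) - k' * (A * B')); last by ring.
  by rewrite ler_norml; apply/andP; split; lra.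
rewrite (_ : (1 + e) * _ = k' * (((1 + e) * (A' * - p (Num.sqrt q))) * B)
    + k' * (A * ((1 + e) * (B' * p (Num.sqrt q))))); last by ring.
by rewrite lerD// ler_pM2l// ?ler_wpM2r// ler_wpM2l.
Unshelve. all: by end_near. Qed.

Lemma cutoff_flux_le (e k : K) phi : test_field phi -> 0 < k ->
  (forall q, r ^+ 2 < q < R ^+ 2 ->
    `|cutoff' k q| <= (1 + e) * (- cutoff' k q * p (Num.sqrt q))) ->
  (\int[lebesgue_rV K n]_(x in shell)
    (cutoff k (sqn x) * (divergence phi x - (1 + e) * h))%:E <= 0)%E.
Proof.
move=> phiT k0 ke; have [phiD [M phiM]] := test_field_C1_vector phiT.
have [_ _ phi1] := phiT.
(* The tolerance 1 is arbitrary: only a C^1 extension of the calibrating field is wanted, since the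
   cutoff vanishes outside the shell. *)
have [N [f [f' [fC f_eq _ _]]]] := calibration n2 r0 rR ltr01.
have fD := C1_vector_scale (C1_scalar_radial fC) (@C1_vector_id K n).
have mfD := C1_vector_scale (C1_scalar_const (- (1 + e))) fD.
pose Psi x : 'rV[K]_n := phi x + - (1 + e) *: (f (sqn x) *: x).
have PsiD : C1_vector Psi _ := C1_vector_add phiD mfD.
have kD := @C1_scalar_radial K n _ _ (C1_cutoff k).
have WD := C1_vector_scale kD PsiD.
pose W x := cutoff k (sqn x) *: Psi x.
have in_shell x : r ^+ 2 < sqn x < R ^+ 2 -> shell x.
  by rewrite (shell_sqn _ (ltW r0) (ltW R0)).
have divW x : divergence W x =
    \sum_i cutoff' k (sqn x) * (2 * x 0 i) * Psi x 0 i
    + cutoff k (sqn x) * (divergence phi x - (1 + e) *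
      (2 * sqn x * f' (sqn x) + n%:R * f (sqn x))).
  rewrite (divergence_scale x kD); last by eexists; exact: PsiD.
  rewrite divergence_add; [|by eexists; exact: phiD|by eexists; exact: mfD].
  rewrite (divergence_scale x (C1_scalar_const _)); last by eexists; exact: fD.
  rewrite (divergence_radial x fC) [X in _ + (X + _)]big1 ?add0r ?mulNr// => i _.
  by rewrite mul0r.
have cdivW : continuous (divergence W).
  by apply: continuous_divergence; exact: C1_vectorP WD.
have cdiv : continuous (divergence phi).
  by apply: continuous_divergence; exact: C1_vectorP phiD.
have ck : continuous (fun x : 'rV[K]_n => cutoff k (sqn x)) by have [] := kD.
have cg : continuous (fun x => cutoff k (sqn x) * (divergence phi x - (1 + e) * h)).
  by move=> x; exact: (cvgM (ck x) (cvgB (cdiv x) (cvg_cst _))).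
have mshell := @measurable_shell K n r R.
have shR := @shell_cube K n r R.
have <- : (\int[lebesgue_rV K n]_(x in shell) (divergence W x)%:E = 0)%E.
  have WR x : W x != 0 -> cube R x.
    move=> Wx; apply: shR; apply: in_shell; apply: contraNT Wx.
    by move=> /(cutoff_out k0)[kx _]; rewrite /W kx scale0r.
  rewrite -(integral_divergence_eq0 WD WR) integral_mkcond.
  apply: eq_integral => x _; rewrite /patch; case: ifPn => // /negP xsh.
  have /(cutoff_out k0)[kx k'x] : ~~ (r ^+ 2 < sqn x < R ^+ 2).
    by apply/negP => /in_shell xA; apply: xsh; exact/mem_set.
  by rewrite divW kx k'x mul0r addr0 big1// => i _; rewrite !mul0r.
apply: le_integral.
- exact: mshell.
- exact: integrable_cube mshell cg shR.
- exact: integrable_cube mshell cdivW shR.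
move=> x /set_mem xA; rewrite lee_fin divW.
have [x0 /f_eq[fx f'x] /ke kex] := shell_bounds r0 rR xA.
rewrite fx f'x radial_coef_divergence// lerDr.
(* The gradient of the cutoff is 2 [cutoff'] x. Paired with [Psi] it leaves x . phi, of size at most
   |x| by Cauchy-Schwarz, and |x| g(|x|), which dominates it by [ke]. *)
have -> : \sum_i cutoff' k (sqn x) * (2 * x 0 i) * Psi x 0 i =
    2 * (cutoff' k (sqn x) * \sum_i x 0 i * phi x 0 i
      + (1 + e) * (- cutoff' k (sqn x) * (sqn x * radial_coef n r R (sqn x)))).
  rewrite -[X in _ = 2 * (_ + (1 + e) * (_ * (X * _)))]/(\sum_i x 0 i ^+ 2).
  rewrite mulr_suml !mulr_sumr -big_split/= mulr_sumr; apply: eq_bigr => i _.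
  by rewrite /Psi !mxE fx; ring.
have e0 : 0 < enorm x by rewrite enormE sqrtr_gt0.
have -> : sqn x * radial_coef n r R (sqn x) = p (enorm x) * enorm x.
  by rewrite -radial_coefE// -enormE -mulrA -expr2 sqr_enorm mulrC.
rewrite pmulr_rge0// -lerBlDl sub0r.
apply: (@le_trans _ _ (`|cutoff' k (sqn x)| * enorm x)).
  apply: le_trans (ler_norm _) _; rewrite normrN normrM ler_wpM2l//.
  exact: dot_le_enorm (phi1 x).
rewrite [- _ * (p _ * _)]mulrA [(1 + e) * (_ * enorm x)]mulrA ler_pM2r//.
Qed.

(** Dominated convergence in [cutoff_flux_le]: at each point of the open shell the cutoff is
    eventually equal to 1. *)
Lemma shell_flux_le (e : K) phi : 0 < e -> test_field phi ->
  (\int[lebesgue_rV K n]_(x in shell) (divergence phi x - (1 + e) * h)%:E <= 0)%E.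
Proof.
move=> e0 phiT; have [phiD _] := test_field_C1_vector phiT.
have mshell := @measurable_shell K n r R.
have shR := @shell_cube K n r R.
pose g x := divergence phi x - (1 + e) * h.
have cg : continuous g.
  have cdiv := continuous_divergence (C1_vectorP phiD).
  by move=> x; exact: (cvgB (cdiv x) (cvg_cst _)).
pose u k x := cutoff k%:R (sqn x) * g x.
have cu k : continuous (u k).
  have [ck _] := @C1_scalar_radial K n _ _ (C1_cutoff k%:R).
  by move=> x; exact: (cvgM (ck x) (cg x)).
have ig := integrable_cube mshell cg shR.
have mE (v : 'rV[K]_n -> K) (cv : continuous v) :=
  (measurable_EFinP shell v).2
    (measurable_funTS (continuous_measurable_rV cv)).
have ptw : {ae lebesgue_rV K n, forall x, shell x ->
    (u k x)%:E @[k --> \oo] --> (g x)%:E}.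
  apply: aeW => x xA; apply: cvg_near_cst.
  move: (xA); rewrite (shell_sqn _ (ltW r0) (ltW R0)) => /cutoff_cvg.
  by apply: filterS => k kx; rewrite /u kx mul1r.
have dom : {ae lebesgue_rV K n, forall x k, shell x ->
    (`|(u k x)%:E| <= `|(g x)%:E|)%E}.
  apply: aeW => x k _; rewrite !abse_EFin lee_fin normrM ler_piMl//.
  by have /andP[c0 c1] := cutoff_itv k%:R (sqn x); rewrite ger0_norm.
have [_ _ lim] := dominated_convergence mshell (fun k => mE _ (cu k)) (mE _ cg)
  ptw (integrable_abse ig) dom.
have <- := cvg_lim (@ereal_hausdorff K) lim.
apply: lime_le; first by apply/cvg_ex; eexists; exact: lim.
apply: filterS (cutoff'_profile e0) => k [k0 ke].
exact: cutoff_flux_le.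
Qed.

Lemma perimeter_shell_le m : lebesgue_rV K n shell = m%:E ->
  (perimeter shell <= (h * m)%:E)%E.
Proof.
move=> Am; apply: ge_ereal_sup => _ [phi phiT <-].
have [phiD _] := test_field_C1_vector phiT.
have cdiv := continuous_divergence (C1_vectorP phiD).
have mshell := @measurable_shell K n r R.
have ig := integrable_cube mshell cdiv (@shell_cube K n r R).
pose I := fine (\int[lebesgue_rV K n]_(x in shell) (divergence phi x)%:E)%E.
have IE : (\int[lebesgue_rV K n]_(x in shell) (divergence phi x)%:E = I%:E)%E.
  by rewrite /I fineK//; exact: integrable_fin_num.
rewrite IE lee_fin; apply: le_of_shrinked => e e0.
rewrite ler_pdivrMl ?addr_gt0// -subr_le0 -lee_fin.
apply: le_trans (shell_flux_le e0 phiT); rewrite le_eqVlt; apply/orP; left; apply/eqP.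
rewrite (_ : I - _ = 1 * (- ((1 + e) * h) * m + I)); last by ring.
rewrite -(integral_affine 1 (- ((1 + e) * h)) mshell (@shell_cube K n r R) cdiv Am IE).
by apply: eq_integral => x _; congr EFin; ring.
Qed.


End shell_perimeter.

(** * Sets with vanishing gradient *)

Section boxes.
Context {K : realType}.

(** A continuous step of width 1/k, used only as a derivative, so corners are harmless. Its
    primitive is C^1 and, past the step, equals [t] minus a constant. *)
Definition ramp (k t : K) : K := k * Num.max 0 t - k * Num.max 0 (t - k^-1).
Definition ramp_primitive (k t : K) : K :=
  k / 2 * (sqpos t - sqpos (t - k^-1)).

Lemma C1_ramp_primitive k : C1_real (ramp_primitive k) (ramp k).
Proof.
have sC := C1_real_comp (@C1_sqpos K) (C1_real_affine 1 (- k^-1)).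
have := C1_real_scale (k / 2) (C1_real_add (@C1_sqpos K) (C1_real_opp sC)).
congr C1_real; apply/funext => t; rewrite /ramp_primitive /ramp mul1r//.
by field.
Qed.

Lemma ramp_primitive_eq0 k t : 0 < k -> t <= 0 -> ramp_primitive k t = 0.
Proof.
move=> k0 t0; rewrite /ramp_primitive /sqpos !max_l ?subrr ?mulr0//.
by rewrite subr_le0 (le_trans t0)// invr_ge0 ltW.
Qed.

Lemma ramp_primitiveE k t : 0 < k -> k^-1 <= t ->
  ramp_primitive k t = t - (2 * k)^-1.
Proof.
move=> k0 kt; have t0 : 0 <= t by rewrite (le_trans _ kt)// invr_ge0 ltW.
rewrite /ramp_primitive /sqpos !max_r ?subr_ge0//; field.
by rewrite gt_eqF.
Qed.

Lemma ramp_itv k t : 0 <= k -> 0 <= ramp k t <= 1.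
Proof.
rewrite le_eqVlt => /predU1P[<-|k0]; first by rewrite /ramp !mul0r subrr lexx ler01.
have ki0 : 0 < k^-1 by rewrite invr_gt0.
have kk : k * k^-1 = 1 by rewrite divff// gt_eqF.
rewrite /ramp -mulrBr pmulr_rge0// -[X in _ && (_ <= X)]kk ler_pM2l//.
set j := k^-1 in ki0 *; clearbody j; clear -ki0.
by apply/andP; have [|] := leP 0 t; have [|] := leP 0 (t - j) => ? ?; split; lra.
Qed.

Lemma ramp_eq0 k t : 0 < k -> t <= 0 -> ramp k t = 0.
Proof.
move=> k0 t0; rewrite /ramp !max_l ?mulr0 ?subrr//.
by rewrite subr_le0 (le_trans t0)// invr_ge0 ltW.
Qed.

Lemma ramp_eq1 k t : 0 < k -> k^-1 <= t -> ramp k t = 1.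
Proof.
move=> k0 kt; have t0 : 0 <= t by rewrite (le_trans _ kt)// invr_ge0 ltW.
by rewrite /ramp !max_r ?subr_ge0//; field; rewrite gt_eqF.
Qed.

Definition indic_oc (a b t : K) : K := (a < t <= b)%R%:R.

(** Covers both [ramp] and rescaled [smoothstep]. The value 0 at [s = 0] yields the half-open
    interval matching [lebesgue_rV_box]; equality for large [k] makes pointwise limits immediate. *)
Lemma sigmoid_cvg (g : K -> K -> K) (a b t : K) : a <= b ->
  (forall k s, 0 < k -> s <= 0 -> g k s = 0) ->
  (forall k s, 0 < k -> k^-1 <= s -> g k s = 1) ->
  \forall k \near \oo, g k%:R (t - a) - g k%:R (t - b) = indic_oc a b t.
Proof.
move=> ab g0 g1.
have h c : \forall k \near \oo, g k%:R (t - c) = (c < t)%R%:R.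
  have [tc|ct] := leP t c.
    near=> k; rewrite g0 ?subr_le0//.
    by near: k; exact: nbhs_infty_gtr.
  near=> k; have k0 : 0 < k%:R :> K by near: k; exact: nbhs_infty_gtr.
  rewrite g1// -[leRHS]invrK lef_pV2 ?posrE ?invr_gt0 ?subr_gt0//.
  by near: k; exact: nbhs_infty_ger.
near=> k; rewrite (near (h a) k)// (near (h b) k)// /indic_oc leNgt.
have [bt|tb] /= := ltP b t; last by rewrite subr0 andbT.
by rewrite (le_lt_trans ab bt) subrr.
Unshelve. all: by end_near. Qed.

Definition bump (k a b t : K) : K := smoothstep (k * (t - a)) - smoothstep (k * (t - b)).

Lemma C1_bump k a b : exists w', C1_real (bump k a b) w'.
Proof.
have h c : C1_real (fun t => smoothstep (k * (t - c)))
    (fun t => smoothstep' (k * t + k * - c) * k).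
  have := smoothstep_affine_C1 k (k * - c).
  by congr C1_real; apply/funext => t; rewrite -mulrDr.
by eexists; exact: C1_real_add (h a) (C1_real_opp (h b)).
Qed.

Lemma bump_le1 k a b t : `|bump k a b t| <= 1.
Proof.
have /andP[? ?] := smoothstep_itv (k * (t - a)).
have /andP[? ?] := smoothstep_itv (k * (t - b)).
by rewrite /bump ler_norml; apply/andP; split; lra.
Qed.

Lemma bump_cvg a b t : a <= b ->
  \forall k \near \oo, bump k%:R a b t = indic_oc a b t.
Proof.
move=> ab; apply: (@sigmoid_cvg (fun k s => smoothstep (k * s))) => // k s k0 s0.
  by rewrite smoothstep_eq0// pmulr_rle0.
by rewrite smoothstep_eq1// -ler_pdivrMl// mulr1.
Qed.

Lemma bump_support k a b t : 0 < k -> a <= b -> bump k a b t != 0 -> a <= t <= b + k^-1.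
Proof.
move=> k0 ab; apply: contraNT; rewrite negb_and -!ltNge => /orP[ta|bt].
  rewrite /bump !smoothstep_eq0 ?subrr// pmulr_rle0// subr_le0 ltW//.
  exact: lt_le_trans ab.
rewrite /bump !smoothstep_eq1 ?subrr// -ler_pdivrMl// mulr1 lerBrDr addrC ltW//.
by apply: le_lt_trans bt; rewrite lerD2r.
Qed.

(* a primitive, compactly supported, of the difference of the normalised
   indicator functions of ]a, b] and ]a', b'], up to smoothing at scale 1/k *)
Definition transfer (k a b a' b' t : K) : K :=
  (b - a)^-1 * (ramp_primitive k (t - a) - ramp_primitive k (t - b)) -
  (b' - a')^-1 * (ramp_primitive k (t - a') - ramp_primitive k (t - b')).

Definition transfer' (k a b a' b' t : K) : K :=
  (b - a)^-1 * (ramp k (t - a) - ramp k (t - b)) -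
  (b' - a')^-1 * (ramp k (t - a') - ramp k (t - b')).

Lemma C1_transfer k a b a' b' : C1_real (transfer k a b a' b') (transfer' k a b a' b').
Proof.
have h c : C1_real (fun t => ramp_primitive k (t - c)) (fun t => ramp k (t - c)).
  have := C1_real_comp (C1_ramp_primitive k) (C1_real_affine 1 (- c)).
  by congr C1_real; apply/funext => t; rewrite mul1r ?mulr1.
have d c e z := C1_real_scale z (C1_real_add (h c) (C1_real_opp (h e))).
exact: C1_real_add (d a b _) (C1_real_opp (d a' b' _)).
Qed.

(** To the right of both intervals each normalised difference of primitives equals 1, so the two
    cancel: this is the purpose of dividing by the lengths. *)
Lemma transfer_support k a b a' b' lo hi t : 0 < k -> a < b -> a' < b' ->
  lo <= a -> lo <= a' -> b + k^-1 <= hi -> b' + k^-1 <= hi ->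
  transfer k a b a' b' t != 0 -> lo <= t <= hi.
Proof.
move=> k0 ab ab' la la' bh bh'; apply: contraNT.
rewrite negb_and -!ltNge => /orP[tl|ht]; rewrite /transfer.
  have h c : lo <= c -> ramp_primitive k (t - c) = 0.
    by move=> lc; rewrite ramp_primitive_eq0// subr_le0 (le_trans (ltW tl)).
  have lb := le_trans la (ltW ab); have lb' := le_trans la' (ltW ab').
  by rewrite !h// !subrr !mulr0 subrr.
have h c : c + k^-1 <= hi -> ramp_primitive k (t - c) = t - c - (2 * k)^-1.
  move=> ch; rewrite ramp_primitiveE// lerBrDr addrC.
  exact: le_trans (ltW ht).
have ah : a + k^-1 <= hi by rewrite (le_trans _ bh)// lerD2r ltW.
have ah' : a' + k^-1 <= hi by rewrite (le_trans _ bh')// lerD2r ltW.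
rewrite !h//.
rewrite (_ : _ - _ - _ = b - a); last by ring.
rewrite (_ : t - a' - _ - _ = b' - a'); last by ring.
by rewrite !mulVf ?subrr// subr_eq0 gt_eqF.
Qed.

Lemma transfer'_cvg a b a' b' t : a < b -> a' < b' ->
  \forall k \near \oo, transfer' k%:R a b a' b' t =
    (b - a)^-1 * indic_oc a b t - (b' - a')^-1 * indic_oc a' b' t.
Proof.
move=> ab ab'; near=> k; rewrite /transfer'; congr (_ * _ - _ * _).
  near: k; apply: (@sigmoid_cvg ramp) (ltW ab) _ _.
    exact: ramp_eq0.
  exact: ramp_eq1.
near: k; apply: (@sigmoid_cvg ramp) (ltW ab') _ _.
  exact: ramp_eq0.
exact: ramp_eq1.
Unshelve. all: by end_near. Qed.

Lemma transfer'_le k a b a' b' t : 0 <= k -> a < b -> a' < b' ->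
  `|transfer' k a b a' b' t| <= (b - a)^-1 + (b' - a')^-1.
Proof.
move=> k0 ab ab'.
have h c e : c < e -> `|(e - c)^-1 * (ramp k (t - c) - ramp k (t - e))| <= (e - c)^-1.
  move=> ce; have i0 : 0 < (e - c)^-1 by rewrite invr_gt0 subr_gt0.
  rewrite normrM (ger0_norm (ltW i0)) ger_pMr//.
  have /andP[? ?] := ramp_itv (t - c) k0; have /andP[? ?] := ramp_itv (t - e) k0.
  by rewrite ler_norml; apply/andP; split; lra.
apply: le_trans (ler_normB _ _) _; apply: lerD; exact: h.
Qed.

End boxes.

(** * A zero-one law on boxes *)

Section zero_one_law.
Context {K : realType} {n : nat}.
Implicit Types (x a b : 'rV[K]_n).

(** Applied to all indices but [i], the second conclusion says that the product does not vary in
    direction [i], so differentiation falls on the remaining factor alone. *)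
Lemma C1_tensor (w : 'I_n -> K -> K) (s : seq 'I_n) :
  (forall j, exists w', C1_real (w j) w') ->
  exists Dv, C1_scalar (fun x => \prod_(j <- s) w j (x 0 j)) Dv /\
    forall i, i \notin s -> Dv i = fun=> 0.
Proof.
move=> wC; elim: s => [|j s [Dv [vD Dv0]]].
  exists (fun _ _ => 0); split=> //; have := @C1_scalar_const K n 1.
  by congr C1_scalar; apply/funext => x; rewrite big_nil.
have [w' wj] := wC j.
have D := C1_scalar_mul (C1_scalar_comp wj (C1_scalar_coord j)) vD.
eexists; split; first by move: D; congr C1_scalar; apply/funext => x; rewrite big_cons.
move=> i; rewrite inE negb_or => /andP[ij /Dv0 ->].
by apply/funext => x; rewrite (negbTE ij) mulr0 mul0r mulr0 addr0.
Qed.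

Definition box a b : set 'rV[K]_n := [set x | forall i, a 0 i < x 0 i <= b 0 i].

Lemma measurable_box a b : measurable (box a b).
Proof. exact: measurable_rV_box. Qed.

Lemma prod_indic_oc a b x (i : 'I_n) :
  indic_oc (a 0 i) (b 0 i) (x 0 i) *
    \prod_(j | j != i) indic_oc (a 0 j) (b 0 j) (x 0 j) = \1_(box a b) x.
Proof.
rewrite -(bigD1 i (P := predT) (F := fun j => indic_oc (a 0 j) (b 0 j) (x 0 j)))//=.
rewrite indicE; have [xab|/existsNP[j xj]] := pselect (box a b x).
  by rewrite mem_set// big1// => j _; rewrite /indic_oc xab.
rewrite memNset; last by move=> /(_ j).
have {}xj : indic_oc (a 0 j) (b 0 j) (x 0 j) = 0 by rewrite /indic_oc (negbTE (introN idP xj)).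
by rewrite (bigD1 j)//= xj mul0r.
Qed.

Lemma box_setI a b c d :
  box a b `&` box c d =
  box (\row_j Num.max (a 0 j) (c 0 j)) (\row_j Num.min (b 0 j) (d 0 j)).
Proof.
apply/seteqP; split=> [x [xab xcd] j|x xI].
  have /andP[h1 h2] := xab j; have /andP[h3 h4] := xcd j.
  by rewrite !mxE gt_max le_min h1 h2 h3 h4.
by split=> j; have := xI j; rewrite !mxE gt_max le_min =>
  /andP[/andP[? ?] /andP[? ?]]; apply/andP.
Qed.

(** Half-open boxes generate the Borel sets, as uniqueness of measures in [vol_measurable] requires:
    an open rational box is a countable union of boxes with the upper corner pulled in. *)
Lemma measurable_boxesE :
  @measurable _ 'rV[K]_n = <<s [set A | exists a b, A = box a b] >>.
Proof.
apply/seteqP; split; last first.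
  apply: smallest_sub; first exact: sigma_algebra_measurable.
  by move=> _ [a [b ->]]; exact: measurable_box.
apply: smallest_sub; first exact: smallest_sigma_algebra.
move=> U oU; rewrite (open_rat_boxE oU) bigcup_mkcond.
apply: (@countable_bigcupT_measurable _
  (g_sigma_algebraType [set A | exists a b, A = box a b])) => [|q].
  exact: countableP.
case: ifPn => // _.
have -> : rat_box q = \bigcup_k
    box (\row_i ratr (q.1 0 i)) (\row_i (ratr (q.2 0 i) - k.+1%:R^-1)).
  apply/seteqP; split=> [x xq|x [k _ xk] i]; last first.
    have := xk i; rewrite !mxE => /andP[-> /le_lt_trans]; apply.
    by rewrite gtrBl invr_gt0.
  have : \forall k \near \oo, forall i, x 0 i <= ratr (q.2 0 i) - k.+1%:R^-1.
    apply: filter_forall => i; have /andP[_ xi] := xq i.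
    near=> k; rewrite lerBrDr -lerBrDl -[leRHS]invrK.
    rewrite lef_pV2 ?posrE ?invr_gt0 ?subr_gt0// (@le_trans _ _ k%:R)//.
      by near: k; exact: nbhs_infty_ger.
    by rewrite ler_nat.
  move=> [k _ /(_ k (leqnn k)) xk]; exists k => // i.
  by rewrite !mxE xk andbT; have /andP[] := xq i.
by apply: bigcupT_measurable => k; apply: sub_sigma_algebra; do 2 eexists.
Unshelve. all: by end_near. Qed.

Variables (S : set 'rV[K]_n) (M : K).
Hypotheses (mS : measurable S) (SM : S `<=` cube M).

Let vol a b : K := fine (lebesgue_rV K n (S `&` box a b)).

Lemma lebesgue_rV_cube_sub (E : set 'rV[K]_n) : measurable E -> E `<=` cube M ->
  lebesgue_rV K n E = (fine (lebesgue_rV K n E))%:E.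
Proof.
move=> mE EM; rewrite fineK// ge0_fin_numE//.
apply: le_lt_trans (lebesgue_rV_cube_fin n M); apply: le_measure => //; rewrite inE//.
exact: measurable_cube.
Qed.

Let volE a b : lebesgue_rV K n (S `&` box a b) = (vol a b)%:E.
Proof.
apply: lebesgue_rV_cube_sub; last by move=> x [/SM].
by apply: measurableI => //; exact: measurable_box.
Qed.

Variables (x0 : 'rV[K]_n) (rho : K).
Hypothesis rho0 : 0 < rho.
(** Boxes will stay within [rho] of [x0]; the margin up to [2 * rho] absorbs the smoothing at scale
    1/k. *)
Hypothesis flux0 : forall u Du i, C1_scalar u Du ->
  (forall x, u x != 0 -> forall j, x0 0 j - 2 * rho <= x 0 j <= x0 0 j + 2 * rho) ->
  (\int[lebesgue_rV K n]_(x in S) (Du i x)%:E = 0)%E.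

Let sub_box a b : Prop :=
  forall j, [/\ x0 0 j - rho <= a 0 j, a 0 j < b 0 j & b 0 j <= x0 0 j + rho].

(** [f k] is the derivative in direction [i] of a compactly supported C^1 function, so its integral
    over [S] vanishes. In the limit the volume of [S] in a box is proportional to the side in
    direction [i]. *)
Let vol_transfer a b a' b' (i : 'I_n) : sub_box a b -> sub_box a' b' ->
  (forall j, j != i -> a 0 j = a' 0 j /\ b 0 j = b' 0 j) ->
  (b 0 i - a 0 i)^-1 * vol a b = (b' 0 i - a' 0 i)^-1 * vol a' b'.
Proof.
move=> ab ab' eqi.
have [lai abi bhi] := ab i; have [lai' abi' bhi'] := ab' i.
pose T k t := transfer' k (a 0 i) (b 0 i) (a' 0 i) (b' 0 i) t.
pose v k x := \prod_(j | j != i) bump k (a 0 j) (b 0 j) (x 0 j).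
pose ci := (b 0 i - a 0 i)^-1; pose ci' := (b' 0 i - a' 0 i)^-1.
pose g x := ci * \1_(box a b) x - ci' * \1_(box a' b') x.
pose f k x := T k%:R (x 0 i) * v k%:R x.
have vE k x : v k x = \prod_(j <- [seq j <- index_enum 'I_n | j != i])
    bump k (a 0 j) (b 0 j) (x 0 j) by rewrite big_filter.
have vC k : exists Dv, C1_scalar (v k) Dv /\ Dv i = fun=> 0.
  have [j|Dv [vD Dv0]] := @C1_tensor (fun j => bump k (a 0 j) (b 0 j))
      [seq j <- index_enum 'I_n | j != i]; first exact: C1_bump.
  exists Dv; split; first by move: vD; congr C1_scalar; apply/funext => x; rewrite vE.
  by apply: Dv0; rewrite mem_filter eqxx.
have cf k : continuous (f k).
  have [Dv [[cv _] _]] := vC k%:R.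
  have [_ cT] := C1_transfer k%:R (a 0 i) (b 0 i) (a' 0 i) (b' 0 i).
  move=> x; apply: (cvgM _ (cv x)).
  exact: (continuous_comp (@continuous_coord K n i x) (cT _)).
have f0 : \forall k \near \oo, (\int[lebesgue_rV K n]_(x in S) (f k x)%:E = 0)%E.
  near=> k; have k0 : 0 < k%:R :> K by near: k; exact: nbhs_infty_gtr.
  have kr : k%:R^-1 <= rho.
    rewrite -[leRHS]invrK lef_pV2 ?posrE ?invr_gt0//.
    by near: k; exact: nbhs_infty_ger.
  have [Dv [vD Dv0]] := vC k%:R.
  have uD := C1_scalar_mul
    (C1_scalar_comp (C1_transfer k%:R (a 0 i) (b 0 i) (a' 0 i) (b' 0 i))
      (C1_scalar_coord i)) vD.
  have := flux0 i uD; rewrite Dv0 => <-.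
    by apply: eq_integral => x _; rewrite eqxx !mulr1 mulr0 addr0.
  move=> x; rewrite mulf_eq0 negb_or => /andP[Tx vx] j.
  have [->|ji] := eqVneq j i.
    apply: (transfer_support k0 abi abi' _ _ _ _ Tx).
    - by apply: le_trans lai; rewrite lerD2l lerN2 ler_peMl ?ler1n// ltW.
    - by apply: le_trans lai'; rewrite lerD2l lerN2 ler_peMl ?ler1n// ltW.
    - by rewrite mulr_natl mulr2n addrA lerD.
    - by rewrite mulr_natl mulr2n addrA lerD.
  have [la lab bh] := ab j.
  have wx : bump k%:R (a 0 j) (b 0 j) (x 0 j) != 0.
    by apply: contraNneq vx => wx; rewrite /v (bigD1 j)//= wx mul0r.
  have /andP[ax xb] := bump_support k0 (ltW lab) wx; apply/andP; split.
    by apply: le_trans ax; apply: le_trans la; rewrite lerD2l lerN2 ler_peMl ?ler1n// ltW.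
  by apply: le_trans xb _; rewrite mulr_natl mulr2n addrA lerD.
have mE (u : 'rV[K]_n -> K) (mu : measurable_fun S u) :=
  (measurable_EFinP S u).2 mu.
have mbox c d : measurable_fun S (\1_(box c d) : 'rV[K]_n -> K).
  by apply: measurable_funTS; apply: measurable_indic; exact: measurable_box.
have mg : measurable_fun S g.
  apply: measurable_funB; apply: measurable_funM; try exact: measurable_cst.
    exact: mbox.
  exact: mbox.
have Sfin : (lebesgue_rV K n S < +oo)%E.
  by rewrite (lebesgue_rV_cube_sub mS SM) ltry.
have iC : (lebesgue_rV K n).-integrable S (EFin \o fun=> ci + ci').
  by apply: (integrable_cube (M := M)) => //; exact: cst_continuous.
have ptw : {ae lebesgue_rV K n, forall x, S x ->
    (f k x)%:E @[k --> \oo] --> (g x)%:E}.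
  apply: aeW => x _; apply: cvg_near_cst.
  have bj : \forall k \near \oo, forall j,
      bump k%:R (a 0 j) (b 0 j) (x 0 j) = indic_oc (a 0 j) (b 0 j) (x 0 j).
    by apply: filter_forall => j; apply: bump_cvg; have [_ /ltW] := ab j.
  near=> k; congr EFin; rewrite /f /g /T (near (transfer'_cvg (x 0 i) abi abi') k)//.
  rewrite -!(prod_indic_oc _ _ _ i) mulrBl -!mulrA; congr (_ * (_ * _) - _ * (_ * _)).
    by apply: eq_bigr => j _; rewrite (near bj k).
  apply: eq_bigr => j ji; have [<- <-] := eqi j ji.
  by rewrite (near bj k).
have dom : {ae lebesgue_rV K n, forall x k, S x ->
    (`|(f k x)%:E| <= (ci + ci')%:E)%E}.
  apply: aeW => x k _; rewrite abse_EFin lee_fin normrM -[leRHS]mulr1.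
  apply: ler_pM => //; first exact: transfer'_le.
  rewrite /v normr_prod; apply: prodr_ile1 => j _.
  by rewrite normr_ge0 bump_le1.
have [_ _ lim] := dominated_convergence mS
  (fun k => mE _ (measurable_funTS (continuous_measurable_rV (cf k))))
  (mE _ mg) ptw iC dom.
have : (\int[lebesgue_rV K n]_(x in S) (g x)%:E = 0)%E.
  rewrite -(cvg_lim (@ereal_hausdorff K) lim).
  by apply/cvg_lim => //; exact: cvg_near_cst.
have ibox c d : (lebesgue_rV K n).-integrable S (EFin \o \1_(box c d)).
  apply: measurable_bounded_integrable => //; exists 1; split; first exact: ger0_real.
  by move=> C C1 x _ /=; rewrite ger0_norm// (le_trans _ (ltW C1))// indicE lern1 leq_b1.
have I1 z c d : (\int[lebesgue_rV K n]_(x in S) (z * \1_(box c d) x)%:E =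
    (z * vol c d)%:E)%E.
  under eq_integral do rewrite EFinM.
  rewrite (integralZl mS (ibox c d)) (integral_indic _ mS (measurable_box c d)).
  by rewrite EFinM setIC; congr (_ * _)%E; exact: volE.
have iZ z c d : (lebesgue_rV K n).-integrable S (fun x => (z * \1_(box c d) x)%:E).
  under eq_fun do rewrite EFinM.
  exact: (integrableZl mS z (ibox c d)).
under eq_integral do rewrite EFinB.
rewrite (integralB_EFin mS (iZ ci a b) (iZ ci' a' b')) !I1 -EFinB => -[] /eqP.
by rewrite subr_eq0 => /eqP.
Unshelve. all: by end_near. Qed.
Let lo : 'rV[K]_n := \row_j (x0 0 j - rho).
Let hi : 'rV[K]_n := \row_j (x0 0 j + rho).

Let sub_box_lohi : sub_box lo hi.
Proof. by move=> j; rewrite !mxE; split=> //; rewrite ltrD2l gt0_cp. Qed.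

(** The sides of the large box are replaced one at a time by those of the small one; [vol_transfer]
    rescales the volume at each replacement. *)
Let vol_sub a b : sub_box a b ->
  vol a b * (\prod_j (hi 0 j - lo 0 j)) = vol lo hi * \prod_j (b 0 j - a 0 j).
Proof.
move=> ab; pose za k : 'rV[K]_n := \row_j (if (j < k)%N then a 0 j else lo 0 j).
pose zb k : 'rV[K]_n := \row_j (if (j < k)%N then b 0 j else hi 0 j).
have zab k : sub_box (za k) (zb k).
  move=> j; have -> : za k 0 j = if (j < k)%N then a 0 j else lo 0 j by rewrite mxE.
  have -> : zb k 0 j = if (j < k)%N then b 0 j else hi 0 j by rewrite mxE.
  by case: ifP => _; [exact: ab|exact: sub_box_lohi].
have step k : (k <= n)%N -> vol (za k) (zb k) * (\prod_j (hi 0 j - lo 0 j)) =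
    vol lo hi * \prod_j (zb k 0 j - za k 0 j).
  elim: k => [|k IHk] kn.
    have -> : za 0%N = lo by apply/rowP => j; rewrite mxE.
    by have -> : zb 0%N = hi by apply/rowP => j; rewrite mxE.
  pose i := Ordinal kn; have {}IHk := IHk (ltnW kn).
  have eqj j : j != i -> za k.+1 0 j = za k 0 j /\ zb k.+1 0 j = zb k 0 j.
    move=> ji; rewrite !mxE ltnS leq_eqVlt.
    by have /negbTE -> : (j != k :> nat) by move: ji; rewrite -val_eqE.
  have tr := vol_transfer (zab k.+1) (zab k) eqj.
  have len c d : sub_box c d -> d 0 i - c 0 i != 0.
    by move=> /(_ i)[_ cd _]; rewrite subr_eq0 gt_eqF.
  have [l1 l2] := (len _ _ (zab k.+1), len _ _ (zab k)).
  have -> : vol (za k.+1) (zb k.+1) =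
      (zb k.+1 0 i - za k.+1 0 i) * ((zb k 0 i - za k 0 i)^-1 * vol (za k) (zb k)).
    by rewrite -tr mulrA divff// mul1r.
  rewrite -2!mulrA IHk [in RHS](bigD1 i)//= [in LHS](bigD1 i)//=.
  rewrite (eq_bigr (fun j => zb k.+1 0 j - za k.+1 0 j)); last first.
    by move=> j /eqj[-> ->].
  by field.
have <- : za n = a by apply/rowP => j; rewrite mxE ltn_ord.
have <- : zb n = b by apply/rowP => j; rewrite mxE ltn_ord.
exact: step.
Qed.

Let mQ : measurable (box lo hi). Proof. exact: measurable_box. Qed.
Let mSQ : measurable (S `&` box lo hi). Proof. exact: measurableI. Qed.

Let volQ : K := \prod_j (hi 0 j - lo 0 j).

Let volQE : lebesgue_rV K n (box lo hi) = volQ%:E.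
Proof. by apply: lebesgue_rV_box => j; have [_ /ltW] := sub_box_lohi j. Qed.

Let volQ_gt0 : 0 < volQ.
Proof. by apply: prodr_gt0 => j _; have [_ ? _] := sub_box_lohi j; rewrite subr_gt0. Qed.

Let vol_ge0 : 0 <= vol lo hi.
Proof. exact: fine_ge0. Qed.

(** Both sides are measures in [E], finite on the exhausting boxes [g k]; they agree on boxes, which
    are stable under intersection. *)
Let vol_measurable (E : set 'rV[K]_n) : measurable E ->
  (volQ%:E * lebesgue_rV K n (E `&` (S `&` box lo hi)) =
   (vol lo hi)%:E * lebesgue_rV K n (E `&` box lo hi))%E.
Proof.
pose m1 := mscale (NngNum (ltW volQ_gt0)) (mrestr (lebesgue_rV K n) mSQ).
pose m2 := mscale (NngNum vol_ge0) (mrestr (lebesgue_rV K n) mQ).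
move=> mE; suff : m1 E = m2 E by [].
pose g k : set 'rV[K]_n := box (\row__ (- k%:R)) (\row__ k%:R).
apply: (measure_unique [set A | exists a b, A = box a b] g) => //.
- exact: measurable_boxesE.
- by move=> _ _ [a [b ->]] [c [d ->]]; rewrite box_setI; do 2 eexists.
- by move=> k; do 2 eexists.
- rewrite -subTset => x _; exists (Num.trunc `|x|).+1 => // j; rewrite !mxE.
  have xk : `|x| < (Num.trunc `|x|).+1%:R by exact: truncnS_gt.
  have := le_lt_trans (coord_le_norm x j) xk.
  by rewrite ltr_norml => /andP[-> /ltW ->].
- move=> _ [a [b ->]].
  change (volQ%:E * lebesgue_rV K n (box a b `&` (S `&` box lo hi)) =
    (vol lo hi)%:E * lebesgue_rV K n (box a b `&` box lo hi))%E.
  rewrite setICA box_setI; set c := \row_j _; set d := \row_j _.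
  (* The intersection with the box [lo], [hi] is either empty or one of the sub-boxes covered by
     [vol_sub]. *)
  have [cd|/existsNP[j /negP]] := pselect (forall j, c 0 j < d 0 j); last first.
    rewrite -leNgt => dc; have -> : box c d = set0.
      rewrite -subset0 => x /(_ j)/andP[cx xd].
      by have := lt_le_trans cx (le_trans xd dc); rewrite ltxx.
    by rewrite setI0 !measure0 !mule0.
  have sub : sub_box c d.
    move=> j; split=> //; first by rewrite !mxE le_max lexx orbT.
    by rewrite !mxE ge_min lexx orbT.
  rewrite volE lebesgue_rV_box => [|j]; last exact: ltW.
  by rewrite -!EFinM mulrC (vol_sub sub).
- move=> k.
  change (volQ%:E * lebesgue_rV K n (g k `&` (S `&` box lo hi)) < +oo)%E.
  apply: lte_mul_pinfty => //; first by rewrite lee_fin ltW.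
  apply: (@le_lt_trans _ _ (lebesgue_rV K n (S `&` box lo hi))).
    by apply: le_measure; rewrite ?inE//; apply: measurableI => //; exact: measurable_box.
  by rewrite volE ltry.
Qed.

(** Inserting [E = S] in [vol_measurable] gives [(volQ - vol lo hi) * vol lo hi = 0]. *)
Lemma zero_one_law :
  lebesgue_rV K n (box lo hi `&` S) = 0%E \/ lebesgue_rV K n (box lo hi `\` S) = 0%E.
Proof.
have := vol_measurable mS; rewrite setIA setIid volE -!EFinM => -[/eqP].
rewrite -subr_eq0 -mulrBl mulf_eq0 subr_eq0 => /orP[/eqP volQ_eq|/eqP vol0].
  right; have Qfin : (lebesgue_rV K n (box lo hi) < +oo)%E by rewrite volQE ltry.
  rewrite (measureD mQ mS Qfin).
  transitivity (volQ%:E - (vol lo hi)%:E)%E; last by rewrite volQ_eq subee.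
  by congr (_ - _)%E; [exact: volQE|rewrite setIC; exact: volE].
by left; rewrite setIC volE vol0.
Qed.

End zero_one_law.

(** * Connectedness of the shell *)

Section shell_connected.
Context {K : realType} {n : nat}.
Implicit Types (x y z : 'rV[K]_n).

Let dot x y : K := \sum_k x 0 k * y 0 k.

Lemma sqn_gt0 x : (0 < sqn x) = (x != 0).
Proof.
have [->|x0] := eqVneq x 0.
  by rewrite /sqn big1 ?ltxx// => i _; rewrite mxE expr0n.
rewrite lt_neqAle sqn_ge0 andbT eq_sym psumr_eq0; last by move=> i _; exact: sqr_ge0.
apply: contra x0 => /allP x0; apply/eqP/rowP => i; rewrite mxE.
by have := x0 i (mem_index_enum i); rewrite sqrf_eq0 => /eqP.
Qed.

Lemma enorm_gt0 x : (0 < enorm x) = (x != 0).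
Proof. by rewrite enormE sqrtr_gt0 sqn_gt0. Qed.

Let segment x y (t : K) : 'rV[K]_n := (1 - t) *: x + t *: y.

(** By Pythagoras the squared norm is (1 - t)^2 |x|^2 + t^2 |y|^2, whose terms never vanish
    together. *)
Let segment_orthogonal_neq0 x y t : x != 0 -> y != 0 -> dot x y = 0 -> segment x y t != 0.
Proof.
move=> x0 y0 xy; rewrite -sqn_gt0.
have -> : sqn (segment x y t) =
    (1 - t) ^+ 2 * sqn x + 2 * (1 - t) * t * dot x y + t ^+ 2 * sqn y.
  rewrite /sqn /dot !mulr_sumr -!big_split/=; apply: eq_bigr => i _.
  by rewrite /segment !mxE; ring.
rewrite xy mulr0 addr0; have [->|t0] := eqVneq t 0.
  by rewrite subr0 expr1n mul1r expr0n mul0r addr0 sqn_gt0.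
apply: ltr_wpDl; first by rewrite mulr_ge0 ?sqr_ge0 ?sqn_ge0.
by rewrite mulr_gt0 ?sqn_gt0// exprn_even_gt0.
Qed.

Variables (r R : K).
Hypotheses (n2 : (2 <= n)%N) (r0 : 0 < r) (rR : r < R).

Local Notation shell := (spherical_shell (R := K) n r R).

Lemma shell_neq0 x : shell x -> x != 0.
Proof. by rewrite -enorm_gt0 => /andP[+ _]; exact: lt_trans. Qed.

(** Rescaling the segment so that its norm interpolates linearly between those of [x] and [y] keeps
    it in the shell; the origin is the only obstruction. *)
Let segment_component x y : shell x -> shell y ->
  (forall t : K, 0 <= t <= 1 -> segment x y t != 0) -> connected_component shell x y.
Proof.
move=> xA yA seg0.
pose lam (t : K) := (1 - t) * enorm x + t * enorm y.
pose gamma t : 'rV[K]_n := (lam t / enorm (segment x y t)) *: segment x y t.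
have clin (a b : K) : continuous (fun t : K => (1 - t) * a + t * b).
  move=> t; apply: cvgD; apply: cvgM; try exact: cvg_cst; last exact: cvg_id.
  by apply: cvgB; [exact: cvg_cst|exact: cvg_id].
have cseg : continuous (segment x y).
  apply: continuous_rV => i.
  have -> : (fun t => segment x y t 0 i) = (fun t => (1 - t) * x 0 i + t * y 0 i).
    by apply/funext => t; rewrite /segment !mxE.
  exact: clin.
have lam_itv t : 0 <= t <= 1 -> r < lam t < R.
  have /andP[rx xR] := xA; have /andP[ry yR] := yA => /andP[t0 t1].
  rewrite /lam; set a := enorm x in rx xR *; set b := enorm y in ry yR *.
  have [->|tn0] := eqVneq t 0; first by rewrite subr0 mul1r mul0r addr0 rx xR.
  have tp : 0 < t by rewrite lt_neqAle eq_sym tn0 t0.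
  have h1 : 0 <= (1 - t) * (a - r) by rewrite mulr_ge0 ?subr_ge0// ltW.
  have h2 : 0 <= (1 - t) * (R - a) by rewrite mulr_ge0 ?subr_ge0// ltW.
  have h3 : 0 < t * (b - r) by rewrite mulr_gt0// subr_gt0.
  have h4 : 0 < t * (R - b) by rewrite mulr_gt0// subr_gt0.
  by apply/andP; split; nra.
have gammaA : [set gamma t | t in `[0, 1]] `<=` shell.
  move=> _ [t t01 <-]; rewrite /= in_itv/= in t01.
  have s0 : 0 < enorm (segment x y t) by rewrite enorm_gt0 seg0.
  have /andP[l1 l2] := lam_itv t t01.
  rewrite /spherical_shell /= enormZ normrM normfV (ger0_norm (enorm_ge0 _)).
  rewrite -mulrA mulVf ?gt_eqF// mulr1 ger0_norm ?l1 ?l2//.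
  exact: ltW (lt_trans r0 l1).
have seg0E : segment x y 0 = x by rewrite /segment subr0 scale1r scale0r addr0.
have seg1E : segment x y 1 = y by rewrite /segment subrr scale0r scale1r add0r.
have gamma_conn : connected [set gamma t | t in `[0, 1]].
  apply: connected_continuous_connected; first exact: segment_connected.
  apply: continuous_in_subspaceT => t /set_mem; rewrite /= in_itv/= => t01.
  have s0 : enorm (segment x y t) != 0 by rewrite gt_eqF// enorm_gt0 seg0.
  apply: cvgZ; last exact: cseg.
  apply: cvgM; first exact: clin.
  apply: cvgV => //.
  exact: (continuous_comp (cseg t) (@continuous_enorm K n _)).
apply: (connected_component_max _ gammaA gamma_conn).
  exists 0; first by rewrite /= in_itv/= lexx ler01.
  rewrite /gamma /lam seg0E subr0 mul1r mul0r addr0 divff ?scale1r//.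
  by rewrite gt_eqF// enorm_gt0 shell_neq0.
exists 1; first by rewrite /= in_itv/= lexx ler01.
rewrite /gamma /lam seg1E subrr mul1r mul0r add0r divff ?scale1r//.
by rewrite gt_eqF// enorm_gt0 shell_neq0.
Qed.

Let orthogonal_component x w : shell x -> shell w -> dot x w = 0 ->
  connected_component shell x w.
Proof.
move=> xA wA xw; apply: segment_component => // t _.
by apply: segment_orthogonal_neq0 => //; exact: shell_neq0.
Qed.

Let orthogonal_in_shell x : shell x -> exists2 w, shell w & dot x w = 0.
Proof.
move=> xA; have x0 := shell_neq0 xA.
have [i xi] : exists i, x 0 i != 0.
  apply/existsP; apply: contraNT x0; rewrite negb_exists => /forallP x0.
  by apply/eqP/rowP => i; rewrite mxE; have := x0 i; rewrite negbK => /eqP.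
have [j ji] : exists j, j != i.
  have [i0|i0] := eqVneq (i : nat) 0%N.
    (* [n2] reads as [1 < n], so [Ordinal n2] is index 1. *)
    by exists (Ordinal n2); rewrite -val_eqE/= i0.
  by exists (Ordinal (ltnW n2)); rewrite -val_eqE/= eq_sym.
pose w0 : 'rV[K]_n := (- x 0 j) *: delta_mx 0 i + x 0 i *: delta_mx 0 j.
have w00 : w0 != 0.
  apply: contraNneq xi => /(congr1 (fun w : 'rV[K]_n => w 0 j)).
  by rewrite !mxE !eqxx (negbTE ji)/= mulr0 add0r mulr1 => ->.
have dotd k : \sum_l x 0 l * (delta_mx 0 k : 'rV[K]_n) 0 l = x 0 k.
  rewrite (bigD1 k)//= mxE !eqxx mulr1 big1 ?addr0// => l lk.
  by rewrite mxE (negbTE lk) andbF mulr0.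
have dotw : dot x w0 = 0.
  transitivity (- x 0 j * \sum_l x 0 l * (delta_mx 0 i : 'rV[K]_n) 0 l
      + x 0 i * \sum_l x 0 l * (delta_mx 0 j : 'rV[K]_n) 0 l).
    rewrite !mulr_sumr -big_split/=; apply: eq_bigr => l _.
    by rewrite /w0 !mxE; ring.
  by rewrite !dotd; ring.
exists ((enorm x / enorm w0) *: w0).
  rewrite /spherical_shell/= enormZ normrM normfV !(ger0_norm (enorm_ge0 _)).
  by rewrite -mulrA mulVf ?mulr1// gt_eqF// enorm_gt0.
transitivity ((enorm x / enorm w0) * dot x w0); last by rewrite dotw mulr0.
by rewrite /dot mulr_sumr; apply: eq_bigr => l _; rewrite mxE mulrCA.
Qed.

(** A segment through the origin means that [y] is a negative multiple of [x]; a point [w]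
    orthogonal to both then joins them by two admissible segments. *)
Lemma shell_connected : connected shell.
Proof.
have [[x xA]|/set0P/negP/negPn/eqP ->] := pselect (shell !=set0); last exact: connected0.
suff <- : connected_component shell x = shell by exact: component_connected.
apply/seteqP; split=> [|y yA]; first exact: connected_component_sub.
have [seg0|/existsNP[t /not_implyP[t01 /negP/negPn/eqP seg0]]] :=
  pselect (forall t : K, 0 <= t <= 1 -> segment x y t != 0).
  exact: segment_component.
have [w wA xw] := orthogonal_in_shell xA.
apply: (connected_component_trans (y := w)); first exact: orthogonal_component.
apply: connected_component_sym; apply: orthogonal_component => //.
have t0 : t != 0.
  apply: contraTneq xA => t0; apply/negP => /shell_neq0/eqP; apply.
  by move: seg0; rewrite t0 /segment subr0 scale1r scale0r addr0.
have -> : y = (- (1 - t) / t) *: x.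
  apply: (scalerI t0); rewrite scalerA mulrCA divff// mulr1 scaleNr.
  by apply/eqP; rewrite -addr_eq0 addrC; apply/eqP.
rewrite /dot; transitivity (- (1 - t) / t * dot x w); last by rewrite xw mulr0.
by rewrite /dot mulr_sumr; apply: eq_bigr => l _; rewrite mxE mulrA.
Qed.

End shell_connected.

(** * Cheeger sets of the shell *)

Section null_sets.
Context {K : realType} {n : nat}.

Lemma open_lebesgue_rV_gt0 (U : set 'rV[K]_n) : open U -> U !=set0 ->
  (0 < lebesgue_rV K n U)%E.
Proof.
move=> oU [x Ux]; have : U x by []; rewrite {1}(open_rat_boxE oU) => -[q /= qU qx].
(* The half-open box has [x] itself as upper corner and hence stays inside the open rational box
   around [x]. *)
pose a : 'rV[K]_n := \row_i ratr (q.1 0 i).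
have ax i : a 0 i < x 0 i by have /andP[] := qx i; rewrite mxE.
have sub : box a x `<=` U.
  move=> y axy; apply: qU => i; have /andP[ay yx] := axy i; rewrite mxE in ay.
  by rewrite ay (le_lt_trans yx)//; have /andP[] := qx i.
apply: (@lt_le_trans _ _ (lebesgue_rV K n (box a x))).
  rewrite lebesgue_rV_box => [|i]; last exact: ltW.
  by rewrite lte_fin; apply: prodr_gt0 => i _; rewrite subr_gt0.
apply: le_measure => //; rewrite inE; first exact: measurable_box.
exact: open_measurable_rV.
Qed.

Lemma countable_bigcup_null (T : countType) (P : set T) (F : T -> set 'rV[K]_n)
    (E : set 'rV[K]_n) : measurable E -> (forall q, measurable (F q)) ->
  (forall q, P q -> lebesgue_rV K n (F q `&` E) = 0%E) ->
  measurable (\bigcup_(q in P) F q) ->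
  lebesgue_rV K n ((\bigcup_(q in P) F q) `&` E) = 0%E.
Proof.
move=> mE mF F0 mU.
(* Re-indexes the union by codes in the natural numbers; codes of no element of [P] get the empty
   set. *)
pose G k : set 'rV[K]_n :=
  if unpickle k is Some q then if `[< P q >] then F q `&` E else set0 else set0.
have -> : (\bigcup_(q in P) F q) `&` E = \bigcup_k G k.
  apply/seteqP; split=> [x [[q Pq Fx] Ex]|x [k _]].
    by exists (pickle q) => //; rewrite /G pickleK asboolT.
  rewrite /G; case: unpickle => // q; case: ifPn => // /asboolP Pq [Fx Ex].
  by split=> //; exists q.
have mG k : measurable (G k).
  by rewrite /G; case: unpickle => // q; case: ifPn => // _; exact: measurableI.
apply: measure_negligible; first exact: bigcupT_measurable.
apply: negligible_bigcup => k; apply/negligibleP; first exact: mG.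
rewrite /G; case: unpickle => [q|]; last exact: measure0.
by case: ifPn => [/asboolP|_]; [exact: F0|exact: measure0].
Qed.

End null_sets.

Lemma open_rat_box {K : realType} n q : open (@rat_box K n q).
Proof.
rewrite openE => x qx; rewrite /interior /rat_box; apply: (@filter_forall _ _ _ (nbhs x)) => i.
have /andP[qx1 qx2] := qx i.
near=> y; apply/andP; split; near: y.
  exact: (@continuous_coord K n i x _ (lt_nbhsr qx1)).
exact: (@continuous_coord K n i x _ (lt_nbhsl qx2)).
Unshelve. all: by end_near. Qed.

(** * Sets attaining the calibration bound *)

Section rigidity.
Context {K : realType} {n : nat} (r R : K).
Hypotheses (n2 : (2 <= n)%N) (r0 : 0 < r) (rR : r < R).
Implicit Types (x y : 'rV[K]_n).

Local Notation shell := (spherical_shell (R := K) n r R).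
Local Notation h := (n%:R * slope n r R).

Variables (S : set 'rV[K]_n) (m : K).
Hypotheses (mS : measurable S) (Sshell : S `<=` shell).
Hypotheses (Sm : lebesgue_rV K n S = m%:E) (PS : perimeter S = (h * m)%:E).

Let SR : S `<=` cube R. Proof. by move=> x /Sshell; exact: shell_cube. Qed.

(** Removes the bound [|u x| <= 1] by scaling: [u] is continuous and its support lies in a cube. *)
Lemma flux_eq0 u Du a b i : C1_scalar u Du ->
  r ^+ 2 < a -> b < R ^+ 2 -> (forall x, u x != 0 -> a <= sqn x <= b) ->
  (\int[lebesgue_rV K n]_(x in S) (Du i x)%:E = 0)%E.
Proof.
move=> uD ra bR uab; have [cu /(_ i)[_ cDu]] := uD.
have [C C0 uC] := bounded_on_cube (1 + b) cu.
have C1 : 0 < C + 1 by rewrite ltr_wpDl.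
have := perimeter_eq_flux0 n2 r0 rR i mS Sshell Sm PS
  (C1_scalar_scale (C + 1)^-1 uD) _ ra bR _.
under eq_integral do rewrite EFinM.
rewrite (integralZl mS (integrable_cube mS cDu SR)) => int0.
have /eqP : ((C + 1)^-1%:E * \int[lebesgue_rV K n]_(x in S) (Du i x)%:E = 0)%E.
  apply: int0 => x.
    have [->|ux] := eqVneq (u x) 0; first by rewrite mulr0 normr0.
    rewrite normrM normfV (gtr0_norm C1) ler_pdivrMl// mulr1.
    rewrite (le_trans (uC x _)) ?lerDl// => j.
    apply: le_trans (coord_le_sqn x j) _; rewrite lerD2l.
    by have /andP[] := uab _ ux.
  by rewrite mulf_eq0 negb_or => /andP[_]; exact: uab.
by rewrite mule_eq0 eqe invr_eq0 gt_eqF//= => /eqP.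
Qed.

Lemma shell_locally_null_or_full x : shell x ->
  exists V : set 'rV[K]_n, [/\ open V, V x, V `<=` shell &
    lebesgue_rV K n (V `&` S) = 0%E \/ lebesgue_rV K n (V `&` (shell `\` S)) = 0%E].
Proof.
move=> xA; have [_ _ /andP[rx xR]] := shell_bounds r0 rR xA.
(* Midpoints, which leave room for a neighbourhood of [x] whose squared norms stay in a compact part
   of the shell. *)
pose a := (r ^+ 2 + sqn x) / 2; pose b := (sqn x + R ^+ 2) / 2.
have [ra ax] : r ^+ 2 < a /\ a < sqn x by split; rewrite /a; lra.
have [xb bR] : sqn x < b /\ b < R ^+ 2 by split; rewrite /b; lra.
have : \forall y \near x, a < sqn y < b.
  near=> y; apply/andP; split; near: y.
    exact: (@continuous_sqn K n x _ (lt_nbhsr ax)).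
  exact: (@continuous_sqn K n x _ (lt_nbhsl xb)).
move=> /nbhs_ballP[e /= e0 eab].
have {}e0 : (0 : K) < e by [].
(* With a quarter of the radius, even the doubled box on which test functions live fits in the ball
   of radius [e]. *)
pose rho := e / 4; have rho0 : 0 < rho by rewrite divr_gt0.
have near_ab y : (forall j, x 0 j - 2 * rho <= y 0 j <= x 0 j + 2 * rho) ->
    a < sqn y < b.
  move=> xy; apply: eab; split=> // i j; rewrite ord1 -ball_normE /ball_/=.
  have /andP[] := xy j; rewrite /rho ltr_norml => h1 h2.
  by apply/andP; split; lra.
have flux0 u Du i : C1_scalar u Du ->
    (forall y, u y != 0 -> forall j, x 0 j - 2 * rho <= y 0 j <= x 0 j + 2 * rho) ->
    (\int[lebesgue_rV K n]_(y in S) (Du i y)%:E = 0)%E.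
  move=> uD ux; apply: (flux_eq0 i uD ra bR) => y /ux /near_ab /andP[ay yb].
  by rewrite !ltW.
have zol := zero_one_law mS SR rho0 flux0; set Q := box _ _ in zol.
have ballQ : ball x rho `<=` Q.
  move=> y [_ xy] j; have := xy 0 j; rewrite -ball_normE /ball_/= !mxE ltr_distl.
  by move=> /andP[h1 h2]; apply/andP; split; [|apply: ltW]; clear eab; lra.
have mQ : measurable Q by exact: measurable_box.
have mball : measurable (ball x rho).
  by apply: open_measurable_rV; exact: ball_open.
have mshell := @measurable_shell K n r R.
exists (ball x rho); split.
- exact: ball_open.
- exact: ballxx.
- move=> y /ballQ Qy; rewrite (shell_sqn _ (ltW r0) (ltW (lt_trans r0 rR))).
  have /near_ab/andP[ay yb] : forall j, x 0 j - 2 * rho <= y 0 j <= x 0 j + 2 * rho.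
    move=> j; have := Qy j; rewrite !mxE => /andP[h1 h2].
    by apply/andP; split; clear eab ballQ; lra.
  by rewrite (lt_trans ra ay) (lt_trans yb bR).
- case: zol => zol; [left|right]; apply/eqP; rewrite -measure_le0 -zol.
    apply: le_measure; rewrite ?inE; try exact: measurableI.
    by move=> y [/ballQ].
  apply: le_measure; rewrite ?inE.
  + by apply: measurableI => //; exact: measurableD.
  + exact: measurableD.
  + by move=> y [/ballQ Qy [_ Sy]].
Unshelve. all: by end_near. Qed.

Hypothesis m0 : 0 < m.

Lemma shell_full : lebesgue_rV K n (shell `\` S) = 0%E.
Proof.
have mshell := @measurable_shell K n r R.
have mSc : measurable (shell `\` S) by exact: measurableD.
pose null (E : set 'rV[K]_n) := [set q | lebesgue_rV K n (rat_box q `&` E) = 0%E].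
(* For measurable [E] this is the largest open set in which [E] is null ([U0] and [inU]);
   countability of the rational boxes keeps the union null. *)
pose U (E : set 'rV[K]_n) := \bigcup_(q in null E) @rat_box K n q.
have oU E : open (U E) by apply: bigcup_open => q _; exact: open_rat_box.
have mrat q : measurable (@rat_box K n q).
  by apply: open_measurable_rV; exact: open_rat_box.
have U0 E : measurable E -> lebesgue_rV K n (U E `&` E) = 0%E.
  move=> mE; apply: countable_bigcup_null => //.
  by apply: open_measurable_rV; exact: oU.
have inU E (V : set 'rV[K]_n) x : measurable E -> open V -> V x ->
    lebesgue_rV K n (V `&` E) = 0%E -> U E x.
  move=> mE oV; rewrite {1}(open_rat_boxE oV) => -[q /= qV qx] VE.
  exists q => //=; apply/eqP; rewrite -measure_le0 -VE.
  apply: le_measure; rewrite ?inE; try exact: measurableI.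
    by apply: measurableI => //; exact: open_measurable_rV.
  by move=> y [/qV].
have cover x : shell x -> U S x \/ U (shell `\` S) x.
  move=> /shell_locally_null_or_full[V [oV Vx _ [V0|V0]]]; [left|right].
    exact: inU oV Vx V0.
  exact: inU oV Vx V0.
(* Where the two open sets meet inside the shell, both [S] and its complement are null, so a
   nonempty intersection would be an open null set. *)
have disj x : shell x -> U S x -> U (shell `\` S) x -> False.
  move=> xA xU xV; pose W := shell `&` (U S `&` U (shell `\` S)).
  have oW : open W.
    by apply: openI; [exact: open_shell|apply: openI; exact: oU].
  have mW : measurable W by exact: open_measurable_rV.
  have : (0 < lebesgue_rV K n W)%E by apply: open_lebesgue_rV_gt0 => //; exists x.
  apply/negP; rewrite -leNgt.
  have mUS E : measurable E -> measurable (U E `&` E).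
    by move=> mE; apply: measurableI => //; apply: open_measurable_rV; exact: oU.
  apply: (@le_trans _ _ (lebesgue_rV K n ((U S `&` S) `|`
      (U (shell `\` S) `&` (shell `\` S))))).
    apply: le_measure; rewrite ?inE//; first by apply: measurableU; exact: mUS.
    by move=> y [yA [yU yV]]; have [yS|yS] := pselect (S y); [left|right].
  by rewrite (null_set_setU (mUS _ mS) (mUS _ mSc) (U0 _ mS) (U0 _ mSc)).
(* Relative to the shell this set is open, and closed as the complement of [U S]. Were it empty, [S]
   would lie in [U S] and be null, against [0 < m]. *)
have full : shell `&` U (shell `\` S) = shell.
  apply: (shell_connected n2 r0).
  - apply/set0P/eqP => e0.
    have /eqP : lebesgue_rV K n S = 0%E.
      apply/eqP; rewrite -measure_le0 -(U0 S mS); apply: le_measure; rewrite ?inE//.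
        by apply: measurableI => //; apply: open_measurable_rV; exact: oU.
      move=> y yS; split=> //; have [//|yV] := cover y (Sshell yS).
      by have : set0 y by rewrite -e0; split=> //; exact: Sshell.
    by rewrite Sm eqe gt_eqF.
  - by exists (U (shell `\` S)).
  - exists (~` U S); first exact: open_closedC.
    apply/seteqP; split=> x [xA xU]; split=> //.
      by move=> xV; exact: disj xV xU.
    by have [|] := cover x xA.
apply/eqP; rewrite -measure_le0 -(U0 _ mSc); apply: le_measure; rewrite ?inE//.
  by apply: measurableI => //; apply: open_measurable_rV; exact: oU.
move=> y yS; split=> //.
have [] : (shell `&` U (shell `\` S)) y by rewrite full; case: yS.
by [].
Qed.

End rigidity.

Theorem theorem2 (K : realType) (d : nat) (r R : K) (hd : (2 <= d)%N)
    (hr : 0 < r) (hrR : r < R) :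
  minimal_cheeger_set (spherical_shell d r R) /\
  cheeger_constant (spherical_shell d r R) =
    (d%:R * ((R ^+ (d - 1) + r ^+ (d - 1)) / (R ^+ d - r ^+ d)))%:E.
Proof.
rewrite -[(_ / _)]/(slope d r R); set h := d%:R * _; set A := spherical_shell d r R.
have R0 : 0 < R by exact: lt_trans hrR.
have mA : measurable A by exact: measurable_shell.
have volE S : measurable S -> S `<=` A -> exists2 m, 0 <= m & lebesgue_rV K d S = m%:E.
  move=> mS SA; exists (fine (lebesgue_rV K d S)); first exact: fine_ge0.
  by apply: (lebesgue_rV_cube_sub (M := R)) => // x /SA; exact: shell_cube.
have A0 : (0 < lebesgue_rV K d A)%E.
  apply: open_lebesgue_rV_gt0; first exact: open_shell.
  (* A point at the mean radius on a coordinate axis shows that the shell is nonempty, hence of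
     positive measure. *)
  exists (((r + R) / 2) *: delta_mx 0 (Ordinal hd)).
  have d1 : enorm (delta_mx 0 (Ordinal hd) : 'rV[K]_d) = 1.
    rewrite enormE /sqn (bigD1 (Ordinal hd))//= mxE !eqxx big1 ?addr0 ?expr1n ?sqrtr1//.
    by move=> i ii; rewrite mxE (negbTE ii) andbF expr0n.
  rewrite /A /spherical_shell/= enormZ d1 mulr1 ger0_norm; last lra.
  by apply/andP; split; lra.
have quotE S (m p : K) : 0 < m -> lebesgue_rV K d S = m%:E ->
    perimeter S = p%:E -> cheeger_quotient S = (p / m)%:E.
  by move=> m0 Sm Sp; rewrite /cheeger_quotient Sm Sp inver gt_eqF.
have admA : cheeger_admissible A A.
  split=> //; have [M [Mreal cubeM]] := compact_bounded (@compact_cube K d R).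
  exists M; split=> // N MN x /shell_cube; exact: cubeM.
have [mm mm0 Am] := volE A mA (@subset_refl _ A).
have {}mm0 : 0 < mm by move: A0; rewrite Am lte_fin.
have PA : perimeter A = (h * mm)%:E.
  apply/eqP; rewrite eq_le perimeter_shell_le//=.
  exact: (perimeter_ge_measure hd hr hrR).
have quotA : cheeger_quotient A = h%:E by rewrite (quotE _ _ _ mm0 Am PA) mulfK ?gt_eqF.
have admP S : cheeger_admissible A S -> exists m, [/\ 0 < m, lebesgue_rV K d S = m%:E &
    ((h * m)%:E <= perimeter S)%E].
  move=> [SA mS _ S0]; have [m m0 Sm] := volE S mS SA; exists m; split=> //.
    by move: S0; rewrite Sm lte_fin.
  exact: (perimeter_ge_measure hd hr hrR).
have hE : cheeger_constant A = h%:E.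
  apply/eqP; rewrite eq_le; apply/andP; split.
    by rewrite -quotA; apply: ereal_inf_lbound; exists A.
  apply: le_ereal_inf_tmp => _ [S /admP[m [m0 Sm Sp]] <-].
  by rewrite /cheeger_quotient Sm inver gt_eqF// lee_pdivlMr// -EFinM.
split=> //; split; first by split=> //; rewrite quotA hE.
move=> S [admS]; rewrite hE; have [SA mS _ _] := admS.
have [m [m0 Sm _]] := admP S admS.
rewrite /cheeger_quotient Sm inver gt_eqF// => quotS.
have PS : perimeter S = (h * m)%:E.
  have : (perimeter S * (m^-1)%:E * m%:E = h%:E * m%:E)%E by rewrite quotS.
  by rewrite -muleA -EFinM mulVf ?gt_eqF// mule1 -EFinM.
have -> : S `+` A = A `\` S.
  by rewrite /setY (_ : S `\` A = set0) ?set0U// setD_eq0.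
exact: (shell_full hd hr hrR mS SA Sm PS m0).
Qed.
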